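(* Let $n\in\mathbb{N}$ with $n\ge3$ and let $\ell(n)$ be the unique natural number with $3^{\ell(n)}\le n<3^{\ell(n)+1}$. (1) If $n=3^{\ell(n)}$, then $\alpha_{3^{\ell(n)}}:=\{a(\omega):\omega\in I^{\ell(n)}\}$ is the unique optimal set of $n$-means for $P$. (2) If $3^{\ell(n)}<n\le 2\cdot3^{\ell(n)}$, then every set of the form $$\alpha_n(J)=\{a(\omega):\omega\in I^{\ell(n)}\setminus J\}\cup\bigcup_{\omega\in J}S_\omega(\alpha_2^{(\omega)}),$$ where $J\subset I^{\ell(n)}$ with $\mathrm{card}(J)=n-3^{\ell(n)}$ and, for each $\omega\in J$, $\alpha_2^{(\omega)}$ is an optimal set of two-means for $P$, is an optimal set of $n$-means for $P$; and the number of such sets is $\binom{3^{\ell(n)}}{n-3^{\ell(n)}}\,3^{\,n-3^{\ell(n)}}$. (3) If $2\cdot3^{\ell(n)}<n<3^{\ell(n)+1}$, then every set of the form $$\alpha_n(J)=\bigcup_{\omega\in J}S_\omega(\alpha_3)\cup\bigcup_{\omega\in I^{\ell(n)}\setminus J}S_\omega(\alpha_2^{(\omega)}),$$ where $J\subset I^{\ell(n)}$ with $\mathrm{card}(J)=n-2\cdot3^{\ell(n)}$, $\alpha_3$ is an optimal set of three-means for $P$ and, for each $\omega\in I^{\ell(n)}\setminus J$, $\alpha_2^{(\omega)}$ is an optimal set of two-means for $P$, is an optimal set of $n$-means for $P$; and the number of such sets is $\binom{3^{\ell(n)}}{n-2\cdot3^{\ell(n)}}\,3^{\,3^{\ell(n)+1}-n}$.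 In all cases the $n$th quantization error is $$V_n=\frac12\cdot\frac{1}{27^{\ell(n)+1}}\left(13\cdot3^{\ell(n)}-4n\right).$$
   Context: Let $S_1,S_2,S_3:\mathbb{R}^2\to\mathbb{R}^2$ be $S_1(x_1,x_2)=\frac13(x_1,x_2)$, $S_2(x_1,x_2)=\frac13(x_1,x_2)+\frac23(1,0)$, $S_3(x_1,x_2)=\frac13(x_1,x_2)+\frac23(\frac12,\frac{\sqrt3}{2})$. Let $P$ be the unique Borel probability measure on $\mathbb{R}^2$ with $P=\frac13\sum_{j=1}^3 P\circ S_j^{-1}$; its support is the limit set of $\{S_1,S_2,S_3\}$ (the stretched Sierpiński triangle). For $n\in\mathbb{N}$ the $n$th quantization error of $P$ is $V_n=V_n(P)=\inf\left\{\int\min_{a\in\alpha}\|x-a\|^2\,dP(x):\alpha\subset\mathbb{R}^2,\ \alpha\neq\emptyset,\ \mathrm{card}(\alpha)\le n\right\}$, with $\|\cdot\|$ the Euclidean norm. A set $\alpha$ with at most $n$ elements attaining the infimum is called an optimal set of $n$-means for $P$. Let $I=\{1,2,3\}$. For $\omega=\omega_1\cdots\omega_k\in I^k$ put $S_\omega=S_{\omega_1}\circ\cdots\circ S_{\omega_k}$ and $a(\omega)=S_\omega(\frac12,\frac{\sqrt3}{6})$, where $(\frac12,\frac{\sqrt3}{6})$ is the expectation of a random variable with distribution $P$. For a set $A$, $S_\omega(A)=\{S_\omega(x):x\in A\}$. *)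

(* Defs.v *)
From HB Require Import structures.
From mathcomp Require Import all_boot all_order all_algebra.
From mathcomp Require Import all_classical all_reals all_analysis.
Import Order.TTheory GRing.Theory Num.Theory.
Import numFieldNormedType.Exports.

Set Implicit Arguments.
Unset Strict Implicit.
Unset Printing Implicit Defensive.

Local Open Scope classical_set_scope.
Local Open Scope ring_scope.

(* The product sigma-algebra on the plane is its Borel sigma-algebra. *)
Notation plane R := (measurableTypeR R * measurableTypeR R)%type.

(* The library norm on a product is the maximum norm, hence this one. *)
Definition euclidean_norm (R : realType) (x : plane R) : R :=
  Num.sqrt (x.1 ^+ 2 + x.2 ^+ 2).

(* The letters 1, 2, 3 are encoded as the elements 0, 1, 2 of 'I_3. *)
Definition vertex (R : realType) (j : 'I_3) : plane R :=
  match val j with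
  | 0%N => (0, 0)
  | 1%N => (1, 0)
  | _ => (1 / 2, Num.sqrt 3 / 2)
  end.

Definition S_ (R : realType) (j : 'I_3) (x : plane R) : plane R :=
  (1 / 3 * x.1 + 2 / 3 * (vertex R j).1, 1 / 3 * x.2 + 2 / 3 * (vertex R j).2).

Definition word (k : nat) := k.-tuple 'I_3.

Definition S_word (R : realType) (k : nat) (w : word k) : plane R -> plane R :=
  foldr (fun j f => @S_ R j \o f) id w.

Definition a_ (R : realType) (k : nat) (w : word k) : plane R :=
  S_word w (1 / 2, Num.sqrt 3 / 6).

Definition self_similar (R : realType) (P : probability (plane R) R) : Prop :=
  forall B : set (plane R), measurable B ->
    P B = ((1 / 3)%:E * \sum_(j < 3) P (@S_ R j @^-1` B))%E.

(* Used only for finite nonempty A, where the infimum is a minimum. *)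
Definition sqdist (R : realType) (x : plane R) (A : set (plane R)) : R :=
  inf [set euclidean_norm (x - a) ^+ 2 | a in A].

Definition distortion (R : realType) (P : probability (plane R) R)
    (A : set (plane R)) : \bar R :=
  (\int[P]_x (sqdist x A)%:E)%E.

Definition codebook (R : realType) (n : nat) (A : set (plane R)) : Prop :=
  A !=set0 /\ (A #<= `I_n)%card.

Definition quantization_error (R : realType) (P : probability (plane R) R)
    (n : nat) : \bar R :=
  ereal_inf [set distortion P A | A in [set A | codebook n A]].

Definition optimal_means (R : realType) (P : probability (plane R) R)
    (n : nat) (A : set (plane R)) : Prop :=
  codebook n A /\ distortion P A = quantization_error P n.

Definition alpha_pow (R : realType) (l : nat) : set (plane R) :=
  [set a_ R w | w in [set: word l]].

Definition alpha_low (R : realType) (l : nat) (J : {set word l})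
    (al2 : word l -> set (plane R)) : set (plane R) :=
  [set a_ R w | w in [set w | w \notin J]] `|`
  \bigcup_(w in [set w | w \in J]) (S_word w @` al2 w).

Definition alpha_high (R : realType) (l : nat) (J : {set word l})
    (al3 : set (plane R)) (al2 : word l -> set (plane R)) : set (plane R) :=
  \bigcup_(w in [set w | w \in J]) (S_word w @` al3) `|`
  \bigcup_(w in [set w | w \notin J]) (S_word w @` al2 w).

Definition low_family (R : realType) (P : probability (plane R) R)
    (n l : nat) : set (set (plane R)) :=
  [set A | exists (J : {set word l}) (al2 : word l -> set (plane R)),
    [/\ #|J| = (n - 3 ^ l)%N,
        forall w, w \in J -> optimal_means P 2 (al2 w)
      & A = alpha_low J al2]].

Definition high_family (R : realType) (P : probability (plane R) R)
    (n l : nat) : set (set (plane R)) :=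
  [set A | exists (J : {set word l}) (al3 : set (plane R))
                  (al2 : word l -> set (plane R)),
    [/\ #|J| = (n - 2 * 3 ^ l)%N,
        optimal_means P 3 al3,
        forall w, w \notin J -> optimal_means P 2 (al2 w)
      & A = alpha_high J al3 al2]].

(* Main.v *)
Require Import Defs.
From HB Require Import structures.
From mathcomp Require Import all_boot all_order all_algebra.
From mathcomp Require Import all_classical all_reals all_analysis.
From mathcomp Require Import finmap measurable_realfun zify ring lra.
Import Order.TTheory GRing.Theory Num.Theory.
Import numFieldNormedType.Exports.
Local Open Scope classical_set_scope.
Local Open Scope ring_scope.
Set Implicit Arguments.
Unset Strict Implicit.
Unset Printing Implicit Defensive.

(** The lower bound is a duality argument, as for facility location. Let [g] be
    the centroid and [lambda = 2/27], the drop of the error per point from [n = 1] to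
    [n = 3]. For a point [y], the gain [lambda + |x - g|^2 - |x - y|^2] is affine
    in [x], and [min_a |x - a|^2 >= lambda + |x - g|^2 - sum_a (gain a x)^+] for
    every finite set of points [a]. So if [phi y], the integral of [(gain y)^+],
    never exceeds [lambda], then [n] points have distortion at least
    [V_1 + lambda - n lambda]. As [P] is dominated in the convex order by the
    uniform measure on the nine vertices of the three cells, [phi y <= lambda]
    follows from [|sum_(z in H) z|^2 <= lambda k (9 - k)] for all sets [H] of [k]
    of these nine points (centered at [g]), a finite check in which equality only
    occurs for unions of cells. At level [l] one uses the gain with respect to
    the center of the cell containing [x]; by self-similarity the bound becomes
    [sum_w phi (S_w^-1 a) <= lambda], which holds because a point close to one
    cell of level [l] is far from the others, except for points between two
    neighbouring cells, where both terms are less than [lambda / 2]. The cases of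
    equality give the optimal sets. *)

(** * Rational coordinates *)

Section Coordinates.
Context (R : realType).
Implicit Types (x y z : plane R) (i j k : 'I_3).

(* The second coordinate is multiplied by the square root of 3: in the
   coordinates [cx], [cy] all the data of the problem become rational. *)
Definition cx x : R := x.1.
Definition cy x : R := Num.sqrt 3 * x.2.

Definition dist2 x y : R := (cx x - cx y) ^+ 2 + (cy x - cy y) ^+ 2 / 3.

(** Barycentric coordinates with respect to the three vertices, affine with rational coefficients in
    [cx] and [cy]. *)
Definition bary i x : R :=
  match val i with
  | 0%N => 1 - cx x - cy x / 3
  | 1%N => cx x - cy x / 3
  | _ => 2 / 3 * cy x
  end.

Definition centroid : plane R := (1 / 2, Num.sqrt 3 / 6).

Definition triangle : set (plane R) := [set x | forall i, 0 <= bary i x].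

Definition S_inv j x : plane R :=
  (3 * x.1 - 2 * (vertex R j).1, 3 * x.2 - 2 * (vertex R j).2).

Lemma sqrt3E : Num.sqrt 3 * Num.sqrt 3 = 3 :> R.
Proof. by rewrite -expr2 sqr_sqrtr. Qed.

(** The letters have the form in which [big_ord_recl] produces them, so that case analysis and
    expanded sums simplify alike. *)
Lemma ord3P (Q : 'I_3 -> Prop) : Q ord0 -> Q (lift ord0 ord0) ->
  Q (lift ord0 (lift ord0 ord0)) -> forall i, Q i.
Proof.
move=> Q0 Q1 Q2 [[|[|[|i]]] Hi] //.
- by rewrite (_ : Ordinal Hi = ord0) //; apply: val_inj.
- by rewrite (_ : Ordinal Hi = lift ord0 ord0) //; apply: val_inj.
- by rewrite (_ : Ordinal Hi = lift ord0 (lift ord0 ord0)) //; apply: val_inj.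
Qed.

Lemma eq_plane x y : cx x = cx y -> cy x = cy y -> x = y.
Proof.
case: x y => [x1 x2] [y1 y2]; rewrite /cx /cy /= => -> /mulfI -> //.
Qed.

Lemma cx_vertex j : cx (vertex R j) = nth 0 [:: 0; 1; 1 / 2] j.
Proof. by elim/ord3P: j. Qed.

Lemma cy_vertex j : cy (vertex R j) = nth 0 [:: 0; 0; 3 / 2] j.
Proof.
elim/ord3P: j; rewrite /cy /= ?mulr0 //.
by rewrite mulrA sqrt3E.
Qed.

Lemma cx_centroid : cx centroid = 1 / 2. Proof. by []. Qed.

Lemma cy_centroid : cy centroid = 1 / 2.
Proof. by rewrite /cy /= mulrA sqrt3E; lra. Qed.

Lemma cx_S j x : cx (S_ j x) = cx x / 3 + 2 / 3 * cx (vertex R j).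
Proof. by rewrite /cx /=; lra. Qed.

Lemma cy_S j x : cy (S_ j x) = cy x / 3 + 2 / 3 * cy (vertex R j).
Proof. by rewrite /cy /=; ring. Qed.

Lemma cx_S_inv j x : cx (S_inv j x) = 3 * cx x - 2 * cx (vertex R j).
Proof. by []. Qed.

Lemma cy_S_inv j x : cy (S_inv j x) = 3 * cy x - 2 * cy (vertex R j).
Proof. by rewrite /cy /=; ring. Qed.

Lemma S_K j : cancel (@S_ R j) (S_inv j).
Proof.
move=> x; apply: eq_plane; rewrite ?cx_S_inv ?cx_S ?cy_S_inv ?cy_S; by field.
Qed.

Lemma S_invK j : cancel (S_inv j) (@S_ R j).
Proof.
move=> x; apply: eq_plane; rewrite ?cx_S ?cx_S_inv ?cy_S ?cy_S_inv; by field.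
Qed.

Lemma euclidean_norm_dist2 x y : euclidean_norm (x - y) ^+ 2 = dist2 x y.
Proof.
rewrite /euclidean_norm sqr_sqrtr; last by rewrite addr_ge0 ?sqr_ge0.
rewrite /dist2 /cx /cy /= -mulrBr exprMn sqr_sqrtr; last lra.
by field.
Qed.

Lemma dist2_S j x y : dist2 (S_ j x) y = dist2 x (S_inv j y) / 9.
Proof. by rewrite /dist2 cx_S cy_S cx_S_inv cy_S_inv; field. Qed.

Lemma bary_sum x : bary ord0 x + bary (lift ord0 ord0) x +
  bary (lift ord0 (lift ord0 ord0)) x = 1.
Proof. by rewrite /bary /=; field. Qed.

Lemma bary_S i j x : bary i (S_ j x) = (bary i x + 2 * (i == j)%:R) / 3.
Proof.
elim/ord3P: i; elim/ord3P: j;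
  rewrite /bary cx_S cy_S cx_vertex cy_vertex /=; by field.
Qed.

Lemma bary_S_inv i j x : bary i (S_inv j x) = 3 * bary i x - 2 * (i == j)%:R.
Proof. by rewrite -[x in RHS](S_invK j) bary_S; field. Qed.

Lemma triangle_S j x : triangle x -> triangle (S_ j x).
Proof.
move=> Tx i; rewrite bary_S divr_ge0 // addr_ge0 // mulr_ge0 //; exact: ler0n.
Qed.

Lemma triangle_bound x : triangle x -> `|cx x| <= 1 /\ `|cy x| <= 3.
Proof.
move=> Tx; have := Tx ord0; have := Tx (lift ord0 ord0).
have := Tx (lift ord0 (lift ord0 ord0)); rewrite /bary /= => h1 h2 h3.
by split; rewrite ler_norml; apply/andP; split; lra.
Qed.

Lemma measurable_cx : measurable_fun setT cx.
Proof. exact: measurable_fst. Qed.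

Lemma measurable_cy : measurable_fun setT cy.
Proof. by apply: measurable_funM => //; exact: measurable_snd. Qed.

Lemma measurable_S j : measurable_fun setT (@S_ R j).
Proof.
apply/measurable_fun_pairP; split => /=.
  rewrite (_ : _ \o _ = fun x => 1 / 3 * x.1 + 2 / 3 * (vertex R j).1) //.
  apply: measurable_funD => //; apply: measurable_funM => //.
rewrite (_ : _ \o _ = fun x => 1 / 3 * x.2 + 2 / 3 * (vertex R j).2) //.
apply: measurable_funD => //; apply: measurable_funM => //.
Qed.

Lemma measurable_bary i : measurable_fun setT (bary i).
Proof.
have mx := measurable_cx; have my := measurable_cy.
elim/ord3P: i; rewrite /bary /=.
- apply: measurable_funB; first exact: measurable_funB.
  exact: measurable_funM.
- by apply: measurable_funB => //; exact: measurable_funM.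
- exact: measurable_funM.
Qed.

Definition fat_triangle (r : R) : set (plane R) :=
  [set x | forall i, - r <= bary i x].

Lemma measurable_fat_triangle r : measurable (fat_triangle r).
Proof.
rewrite (_ : fat_triangle r =
    \big[setI/setT]_(i < 3) (bary i @^-1` `[- r, +oo[)).
  apply: bigsetI_measurable => i _; rewrite -[X in measurable X]setTI.
  by apply: measurable_bary.
apply/seteqP; split=> x.
  by move=> Tx; rewrite -bigcap_seq /= => i _ /=; rewrite in_itv /= andbT.
by rewrite -bigcap_seq => Tx i; have := Tx i (mem_index_enum _);
  rewrite /= in_itv /= andbT.
Qed.

Lemma measurable_triangle : measurable triangle.
Proof.
have -> : triangle = fat_triangle 0.
  by apply/seteqP; split=> x Tx i; have := Tx i; rewrite /= oppr0.
exact: measurable_fat_triangle.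
Qed.

End Coordinates.


(** * Integration with respect to the self-similar measure *)

Section SelfSimilarMeasure.
Context (R : realType) (P : probability (plane R) R).
Hypothesis P_self_similar : self_similar P.

Let fat : R -> set (plane R) := @fat_triangle R.

Let measurable_fat r : measurable (fat r).
Proof. exact: measurable_fat_triangle. Qed.

Lemma measurable_preimage_S j (B : set (plane R)) :
  measurable B -> measurable (@S_ R j @^-1` B).
Proof.
by move=> mB; rewrite -[X in measurable X]setTI; apply: measurable_S.
Qed.

(** By [bary_S], a lower bound [- 3 * r] on the coordinates becomes [- r] under each map, so [S_ j]
    sends [fat (3 * r)] into [fat r]. *)
Let fat_le (r : R) : (P (fat (3 * r)) <= P (fat r))%E.
Proof.
rewrite (P_self_similar (measurable_fat r)).
have -> : P (fat (3 * r)) = ((1 / 3)%:E * \sum_(j < 3) P (fat (3 * r)))%E.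
  rewrite -(fineK (fin_num_measure P _ (measurable_fat _))).
  by rewrite sumEFin -EFinM big_const_ord /= ; congr (_%:E); lra.
rewrite lee_pmul2l //.
apply: lee_sum => j _; apply: le_measure; try apply/mem_set.
- exact: measurable_fat.
- by apply: measurable_preimage_S; exact: measurable_fat.
- move=> x xf i; have := xf i; rewrite bary_S.
  by case: (i == j) => /=; rewrite /= => h; lra.
Qed.

(** The sets [fat (3 ^+ k * r)] increase to the whole plane and, by [fat_le], none has larger mass
    than [fat r]. *)
Let fat1 (r : R) : 0 < r -> P (fat r) = 1%E.
Proof.
move=> r0; apply/eqP; rewrite eq_le probability_le1 //=.
have H k : (P (fat (3 ^+ k * r)) <= P (fat r))%E.
  elim: k => [|k IH]; first by rewrite expr0 mul1r.
  by rewrite exprS -mulrA; apply: le_trans (fat_le _) IH.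
have U : \bigcup_k fat (3 ^+ k * r) = setT.
  apply/seteqP; split=> // x _.
  pose M := \sum_i `|@bary R i x|.
  have [k] : exists k : nat, M / r < k%:R.
    by exists (Num.truncn (M / r)).+1; rewrite truncnS_gt.
  rewrite ltr_pdivrMr // => Mk; exists k => // i /=.
  have := ler_norm (- bary i x); rewrite normrN => h.
  have : `|@bary R i x| <= M by rewrite /M (bigD1 i) //= lerDl sumr_ge0.
  suff : k%:R * r <= 3 ^+ k * r by lra.
  rewrite ler_pM2r // -natrX ler_nat ltnW //; exact: ltn_expl.
rewrite -(probability_setT P) -U.
have cv := nondecreasing_cvg_mu (mu := P) (F := fun k => fat (3 ^+ k * r)).
have {}cv : (P \o (fun k => fat (3 ^+ k * r))) @ \oo --> P (\bigcup_k fat (3 ^+ k * r)).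
  apply: cv; first by move=> i; exact: measurable_fat.
    by rewrite U; exact: measurableT.
  move=> a b ab; rewrite subsetEset => x /= h i; apply: le_trans (h i).
  by rewrite lerN2 ler_pM2r // ler_eXn2l //; lra.
rewrite -(cvg_lim _ cv) //.
apply: lime_le; first by apply/cvg_ex; eexists; exact: cv.
by apply: nearW => k; exact: H.
Qed.

(** The triangle is the intersection of the sets [fat r], with [r] the inverse of a positive
    integer, all of full mass. *)
Lemma prob_triangle : P (@triangle R) = 1%E.
Proof.
have N : P (~` @triangle R) = 0%E.
  apply/negligibleP; first by apply: measurableC; exact: measurable_triangle.
  rewrite (_ : ~` _ = \bigcup_k ~` fat (k.+1%:R^-1)).
    apply: negligible_bigcup => k; apply/negligibleP.
      by apply: measurableC; exact: measurable_fat.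
    have : P (~` fat k.+1%:R^-1) = 0%E by rewrite probability_setC ?fat1 ?subee.
    by [].
  apply/seteqP; split=> x /=.
    move=> /existsNP [i]; move/negP; rewrite -ltNge => xi.
    have [k hk] : exists k : nat, (- bary i x)^-1 < k%:R.
      by exists (Num.truncn (- bary i x)^-1).+1; rewrite truncnS_gt.
    exists k => //= /(_ i); apply/negP; rewrite -ltNge.
    rewrite ltrNr invf_plt ?unfold_in /= ?oppr_gt0 //.
    by apply: lt_le_trans hk _; rewrite ler_nat.
  move=> [k _ /= h] Tx; apply: h => i; apply: le_trans (Tx i).
  by rewrite oppr_le0 invr_ge0.
have mT := @measurable_triangle R; have := probability_setC P mT.
rewrite -[P (@triangle R)]fineK ?fin_num_measure // => h.
have {h} : 0%E = (1 - fine (P (@triangle R)))%:E by rewrite EFinB -h.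
by move=> [] h; congr (_%:E); lra.
Qed.

Lemma ge0_integral_self_similar (h : plane R -> \bar R) :
  measurable_fun setT h -> (forall x, 0 <= h x)%E ->
  (\int[P]_x h x = (1 / 3)%:E * \sum_(j < 3) \int[P]_x h (S_ j x))%E.
Proof.
move=> mh h0.
pose Sm j : {mfun plane R >-> plane R} :=
  HB.pack (@S_ R j) (isMeasurableFun.Build _ _ _ _ _ (@measurable_S R j)).
(* [msum] takes measures indexed by natural numbers, hence [inord]. *)
pose m_ (k : nat) : {measure set (plane R) -> \bar R} :=
  distribution P (Sm (inord k)).
have t0 : 0 <= 1 / 3 :> R by lra.
rewrite (eq_measure_integral (mscale (NngNum t0) (msum m_ 3))); last first.
  move=> A mA _; rewrite /mscale /= /msum P_self_similar //.
  congr (_ * _)%E; apply: eq_bigr => j _.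
  by rewrite /m_ /= /distribution /pushforward /= inord_val.
rewrite ge0_integral_mscale //=; congr (_ * _)%E.
rewrite ge0_integral_measure_sum //; apply: eq_bigr => j _.
by rewrite /m_ ge0_integral_distribution //= inord_val.
Qed.

End SelfSimilarMeasure.

(** * Averages of functions bounded on the triangle *)

Section Mean.
Context (R : realType).
Implicit Types (x y z : plane R) (h : plane R -> R).

(** Boundedness is asked on the triangle only, which carries [P], so that coordinates and squared
    distances qualify. *)
Definition tame h := measurable_fun setT h /\
  exists K, forall x, triangle x -> `|h x| <= K.

Lemma tame_cst (c : R) : tame (fun=> c).
Proof. by split => //; exists `|c|. Qed.

Lemma tame_cx : tame (@cx R).
Proof.
by split; [exact: measurable_cx|exists 1 => x /triangle_bound[]].
Qed.

Lemma tame_cy : tame (@cy R).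
Proof.
by split; [exact: measurable_cy|exists 3 => x /triangle_bound[]].
Qed.

Lemma tameD h1 h2 : tame h1 -> tame h2 -> tame (fun x => h1 x + h2 x).
Proof.
move=> [m1 [K1 b1]] [m2 [K2 b2]]; split; first exact: measurable_funD.
exists (K1 + K2) => x Tx; apply: le_trans (ler_normD _ _) _.
by apply: lerD; auto.
Qed.

Lemma tameM h1 h2 : tame h1 -> tame h2 -> tame (fun x => h1 x * h2 x).
Proof.
move=> [m1 [K1 b1]] [m2 [K2 b2]]; split; first exact: measurable_funM.
exists (K1 * K2) => x Tx; rewrite normrM.
by apply: ler_pM => //; auto.
Qed.

Lemma tameN h : tame h -> tame (fun x => - h x).
Proof.
move=> [m [K b]]; split; first exact: measurable_funN.
by exists K => x Tx; rewrite normrN; auto.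
Qed.

Lemma tameB h1 h2 : tame h1 -> tame h2 -> tame (fun x => h1 x - h2 x).
Proof. by move=> t1 t2; apply: tameD => //; exact: tameN. Qed.

Lemma tame_max h1 h2 : tame h1 -> tame h2 -> tame (fun x => Num.max (h1 x) (h2 x)).
Proof.
move=> [m1 [K1 b1]] [m2 [K2 b2]]; split; first exact: measurable_maxr.
exists (Num.max K1 K2) => x Tx; rewrite le_max.
by case: (leP (h1 x)) => _; rewrite ?(b1 _ Tx) ?(b2 _ Tx) ?orbT.
Qed.

Lemma tame_min h1 h2 : tame h1 -> tame h2 -> tame (fun x => Num.min (h1 x) (h2 x)).
Proof.
move=> [m1 [K1 b1]] [m2 [K2 b2]]; split; first exact: measurable_minr.
exists (Num.max K1 K2) => x Tx; rewrite le_max.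
by case: (leP (h1 x)) => _; rewrite ?(b1 _ Tx) ?(b2 _ Tx) ?orbT.
Qed.

Lemma tame_S j h : tame h -> tame (fun x => h (S_ j x)).
Proof.
move=> [m [K b]]; split.
  exact: (measurableT_comp m (@measurable_S R j)).
by exists K => x /(triangle_S j); exact: b.
Qed.

Lemma tame_sum (I : Type) (r : seq I) (F : I -> plane R -> R) :
  (forall i, tame (F i)) -> tame (fun x => \sum_(i <- r) F i x).
Proof.
move=> tF; elim: r => [|i r IH].
  by rewrite (_ : (fun _ => _) = fun=> 0); [exact: tame_cst|
     apply/funext => x; rewrite big_nil].
rewrite (_ : (fun _ => _) = fun x => F i x + \sum_(i <- r) F i x).
  exact: tameD.
by apply/funext => x; rewrite big_cons.
Qed.

Lemma tame_bary i : tame (bary i).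
Proof.
split; first exact: measurable_bary.
exists 1 => x Tx; have := Tx ord0; have := Tx (lift ord0 ord0).
have := Tx (lift ord0 (lift ord0 ord0)); have := bary_sum x.
by elim/ord3P: i => *; rewrite ler_norml; apply/andP; split; lra.
Qed.

Lemma tame_sqr h : tame h -> tame (fun x => h x ^+ 2).
Proof. by move=> th; exact: (tameM th th). Qed.

Lemma tame_dist2 y : tame (fun x => dist2 x y).
Proof.
apply: tameD.
  by apply: tame_sqr; apply: tameB; [exact: tame_cx|exact: tame_cst].
apply: tameM; last exact: tame_cst.
by apply: tame_sqr; apply: tameB; [exact: tame_cy|exact: tame_cst].
Qed.

Context (P : probability (plane R) R).

Definition mean h : R := \int[P]_(x in @triangle R) h x.

Hypothesis P_self_similar : self_similar P.

Lemma tame_integrable h : tame h -> P.-integrable (@triangle R) (EFin \o h).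
Proof.
move=> [m [K b]]; apply: measurable_bounded_integrable.
- exact: measurable_triangle.
- by rewrite [X in (X < _)%E](prob_triangle P_self_similar) ltry.
- exact: measurable_funTS.
- exists K; split; first exact: num_real.
  by move=> M KM x /b h1; exact: le_trans h1 (ltW KM).
Qed.

Lemma mean_cst c : mean (fun=> c) = c.
Proof.
rewrite /mean Rintegral_cst; last exact: measurable_triangle.
by rewrite [X in fine X](prob_triangle P_self_similar) mulr1.
Qed.

Lemma meanD h1 h2 : tame h1 -> tame h2 ->
  mean (fun x => h1 x + h2 x) = mean h1 + mean h2.
Proof.
by move=> t1 t2; apply: RintegralD;
  [exact: measurable_triangle|exact: tame_integrable|exact: tame_integrable].
Qed.

Lemma meanZ c h : tame h -> mean (fun x => c * h x) = c * mean h.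
Proof.
by move=> t; apply: RintegralZl;
  [exact: measurable_triangle|exact: tame_integrable].
Qed.

Lemma meanB h1 h2 : tame h1 -> tame h2 ->
  mean (fun x => h1 x - h2 x) = mean h1 - mean h2.
Proof.
by move=> t1 t2; apply: RintegralB;
  [exact: measurable_triangle|exact: tame_integrable|exact: tame_integrable].
Qed.

Lemma eq_mean h1 h2 : (forall x, triangle x -> h1 x = h2 x) ->
  mean h1 = mean h2.
Proof. by move=> e; apply: eq_Rintegral => x /set_mem; exact: e. Qed.

Lemma le_mean h1 h2 : tame h1 -> tame h2 ->
  (forall x, triangle x -> h1 x <= h2 x) -> mean h1 <= mean h2.
Proof.
move=> t1 t2 le12; apply: le_Rintegral => //;
  by [exact: measurable_triangle|exact: tame_integrable].
Qed.

Lemma mean_sum (I : Type) (r : seq I) (F : I -> plane R -> R) :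
  (forall i, tame (F i)) ->
  mean (fun x => \sum_(i <- r) F i x) = \sum_(i <- r) mean (F i).
Proof.
move=> tF; elim: r => [|i r IH].
  rewrite big_nil -[RHS](mean_cst 0); apply: eq_mean => x _.
  by rewrite big_nil.
rewrite big_cons -IH -meanD //; last exact: tame_sum.
by apply: eq_mean => x _; rewrite big_cons.
Qed.

Lemma integral_mean h : tame h -> (forall x, 0 <= h x) ->
  (\int[P]_x (h x)%:E)%E = (mean h)%:E.
Proof.
move=> th h0; have mT := @measurable_triangle R.
rewrite (ge0_negligible_integral (N := ~` @triangle R)) //.
- rewrite setTD setCK /mean /Rintegral fineK //.
  apply: integrable_fin_num => //; exact: tame_integrable.
- exact: measurableC.
- by apply/measurable_EFinP; case: th.
- by move=> x _; rewrite lee_fin.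
- have : P (~` @triangle R) = 0%E by
    rewrite probability_setC // prob_triangle // subee.
  by [].
Qed.

Let mean_self_similar_ge0 h : tame h -> (forall x, 0 <= h x) ->
  mean h = 1 / 3 * \sum_(j < 3) mean (fun x => h (S_ j x)).
Proof.
move=> th h0; apply: EFin_inj; rewrite -integral_mean //.
rewrite (ge0_integral_self_similar P_self_similar) //.
- rewrite [in RHS]EFinM -sumEFin; congr (_ * _)%E; apply: eq_bigr => j _.
  by rewrite -integral_mean //; exact: tame_S.
- by apply/measurable_EFinP; case: th.
Qed.

Lemma mean_self_similar h : tame h ->
  mean h = 1 / 3 * \sum_(j < 3) mean (fun x => h (S_ j x)).
Proof.
move=> th; have [_ [K b]] := th.
(* Adding the bound [K] makes [h] nonnegative on the triangle, and the maximum with 0 makes it so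
   everywhere; the nonnegative case applies to [g]. *)
pose g x := Num.max (h x + K) 0.
have tg : tame g.
  by apply: tame_max; [apply: tameD => //|]; exact: tame_cst.
have gE x : triangle x -> h x = g x - K.
  move=> Tx; rewrite /g max_l ?addrK //.
  by have := b _ Tx; rewrite ler_norml => /andP[? _]; lra.
have meanE (f f' : plane R -> R) : tame f' ->
    (forall x, triangle x -> f x = f' x - K) -> mean f = mean f' - K.
  move=> tf e; rewrite (eq_mean e) meanB ?mean_cst //; exact: tame_cst.
rewrite (meanE _ _ tg gE) mean_self_similar_ge0 //; last first.
  by move=> x; rewrite le_max lexx orbT.
rewrite [in RHS](eq_bigr (fun j => mean (fun x => g (S_ j x)) - K)).
  by rewrite !big_ord_recl !big_ord0; lra.
move=> j _; apply: meanE; first exact: (tame_S j tg).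
by move=> x /(triangle_S j); exact: gE.
Qed.

(** A gap on one cell survives averaging because the cell has weight one third; this gives
    strictness without almost-everywhere arguments. *)
Lemma lt_mean h1 h2 (j : 'I_3) (e : R) : tame h1 -> tame h2 -> 0 < e ->
  (forall x, triangle x -> h1 x <= h2 x) ->
  (forall x, triangle x -> h1 (S_ j x) + e <= h2 (S_ j x)) ->
  mean h1 < mean h2.
Proof.
move=> t1 t2 e0 le12 lt12.
rewrite (mean_self_similar t1) (mean_self_similar t2) ltr_pM2l //.
rewrite (bigD1 j) //= [ltRHS](bigD1 j) //=; apply: ltr_leD.
  have : mean (fun x => h1 (S_ j x)) + e <= mean (fun x => h2 (S_ j x)).
    rewrite -[X in _ + X]mean_cst -meanD; try exact: tame_cst; last first.
      exact: (tame_S j t1).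
    apply: le_mean => //; last exact: (tame_S j t2).
    by apply: tameD; [exact: (tame_S j t1)|exact: tame_cst].
  lra.
apply: ler_sum => i _; apply: le_mean; [exact: (tame_S i t1)|exact: (tame_S i t2)|].
by move=> x /(triangle_S i); exact: le12.
Qed.

(** By self-similarity the mean solves [m = m / 3 + 2 / 9]. Hence the centroid is the expectation of
    [P]. *)
Lemma mean_bary i : mean (bary i) = 1 / 3.
Proof.
have := mean_self_similar (tame_bary i).
have E j : mean (fun x => bary i (S_ j x)) =
    1 / 3 * mean (bary i) + 2 / 3 * (i == j)%:R.
  rewrite -meanZ; last exact: tame_bary.
  rewrite -[X in _ + X]mean_cst -meanD; last exact: tame_cst.
    by apply: eq_mean => x _; rewrite bary_S; field.
  by apply: tameM; [exact: tame_cst|exact: tame_bary].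
rewrite !big_ord_recl big_ord0 !E.
by elim/ord3P: i {E} => /=; lra.
Qed.

End Mean.

(** * The dual bound for the whole triangle *)

Section Gain.
Context (R : realType).
Implicit Types (x y z : plane R) (i j k : 'I_3).

Definition gain y x : R := 2 / 27 + dist2 x (centroid R) - dist2 x y.

Lemma gainE y x : gain y x = 2 / 27 + 2 * (cx y - 1 / 2) * (cx x - 1 / 2) +
  2 / 3 * (cy y - 1 / 2) * (cy x - 1 / 2) -
  (cx y - 1 / 2) ^+ 2 - (cy y - 1 / 2) ^+ 2 / 3.
Proof. by rewrite /gain /dist2 cx_centroid cy_centroid; field. Qed.

(** An affine function is interpolated barycentrically by its values at the vertices of a cell. *)
Lemma gain_bary y j x : gain y (S_ j x) =
  \sum_(i < 3) bary i x * gain y (S_ j (vertex R i)).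
Proof.
rewrite !big_ord_recl big_ord0 !gainE !cx_S !cy_S !cx_vertex !cy_vertex.
rewrite /bary /=; elim/ord3P: j => /=; by field.
Qed.

Lemma gain_bary0 y x : gain y x = \sum_(i < 3) bary i x * gain y (vertex R i).
Proof.
rewrite !big_ord_recl big_ord0 !gainE !cx_vertex !cy_vertex.
by rewrite /bary /=; field.
Qed.

Lemma tame_gain y : tame (gain y).
Proof.
apply: tameB; last exact: tame_dist2.
by apply: tameD; [exact: tame_cst|exact: tame_dist2].
Qed.

Definition cut y x : R := Num.max (gain y x) 0.

Lemma tame_cut y : tame (cut y).
Proof. by apply: tame_max; [exact: tame_gain|exact: tame_cst]. Qed.

Lemma cut_ge0 y x : 0 <= cut y x.
Proof. by rewrite le_max lexx orbT. Qed.

Lemma gain_le_cut y x : gain y x <= cut y x.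
Proof. by rewrite le_max lexx. Qed.

(* The entry [(m, n)] is the vertex of a cell with [cx - 1/2 = m/6] and
   [cy - 1/2 = n/2]. *)
Definition nine_points : seq (int * int) :=
  [:: (-3, -1); (-1, -1); (-2, 0); (1, -1); (3, -1); (2, 0); (-1, 1); (1, 1);
      (0, 2)].

(* Cardinality and coordinate sums of the unions of whole cells. *)
Definition extremal : seq (nat * int * int) :=
  [:: (9, 0, 0); (3, -6, -2); (3, 6, -2); (3, 0, 4); (6, 6, 2); (6, -6, 2);
      (6, 0, -4)].

(* For [k] of the nine points with sums [M] and [N], the inequality
   [3 (M^2 + 3 N^2) <= 8 k (9 - k)] says that their total gain is at most
   [9 * 2/27], for every [y]. *)
Definition tight_or_slack (k : nat) (M N : int) : bool :=
  [|| (k, M, N) == (0%N, 0, 0), (3 * (M ^+ 2 + 3 * N ^+ 2) < 8 * k%:Z * (9 - k%:Z)) |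
      (k, M, N) \in extremal].

(** Each entry is taken or left out, so the leaves run through all subsets, with cardinality and
    coordinate sums carried along. *)
Fixpoint check_subsets (l : seq (int * int)) (k : nat) (M N : int) : bool :=
  if l is (m, n) :: l' then
    check_subsets l' k.+1 (M + m) (N + n) && check_subsets l' k M N
  else tight_or_slack k M N.

Lemma check_nine_points : check_subsets nine_points 0 0 0.
Proof. by vm_compute. Qed.

(** Here [U] and [W] are the offsets of [y] from the centroid, and [2 / 3] is nine times [2 / 27].
    Each positive part is the term itself or 0, so the signs select a path to one leaf of the
    check. *)
Lemma check_subsets_sum (U W : R) l (k : nat) M N : check_subsets l k M N ->
  let q := 2 / 27 - U ^+ 2 - W ^+ 2 / 3 in
  let s := k%:R * q + (U * M%:~R + W * N%:~R) / 3 +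
           \sum_(p <- l) Num.max (q + (U * p.1%:~R + W * p.2%:~R) / 3) 0 in
  s <= 2 / 3 /\ (s = 2 / 3 -> exists2 e, e \in extremal &
    U * (6 * e.1.1%:R) = e.1.2%:~R /\ W * (2 * e.1.1%:R) = e.2%:~R).
Proof.
set q := _ - _ - _ => /=; elim: l k M N => [|[m n] l IH] k M N /=.
  rewrite big_nil addr0 => H.
  have sq0 (a : R) : 0 <= a ^+ 2 by exact: sqr_ge0.
  (* Completing the squares: the deficit times [k] is two squares plus the slack measured by
     [tight_or_slack]. In the case of equality both squares vanish, which determines [U] and [W]. *)
  have key : k%:R * (2 / 3 - (k%:R * q + (U * M%:~R + W * N%:~R) / 3)) =
      (k%:R * U - M%:~R / 6) ^+ 2 + (k%:R * W - N%:~R / 2) ^+ 2 / 3 +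
      (8 * k%:R * (9 - k%:R) - 3 * (M%:~R ^+ 2 + 3 * N%:~R ^+ 2)) / 108.
    by rewrite /q; field.
  have [k0|k0] := posnP k.
    have [M0 N0] : M = 0 /\ N = 0.
      move: H; rewrite /tight_or_slack k0 => /or3P[/eqP[]|H|] //.
      by exfalso; move: H (sqr_ge0 M) (sqr_ge0 N); rewrite mulr0 mul0r; lra.
    by rewrite k0 M0 N0; split; [lra|move=> e; exfalso; lra].
  have {}k0 : 0 < k%:R :> R by rewrite ltr0n.
  move: H => /or3P[/eqP[kE _ _]|H|H]; first by move: k0; rewrite kE ltxx.
    have {}H : 3 * (M%:~R ^+ 2 + 3 * N%:~R ^+ 2) < 8 * k%:R * (9 - k%:R) :> R.
      move: H; rewrite -(ltr_int R) !(rmorphM, rmorphD, rmorphB, rmorphXn) /=.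
      by rewrite rmorphN /= -!pmulrn; lra.
    have : 0 < k%:R * (2 / 3 - (k%:R * q + (U * M%:~R + W * N%:~R) / 3)).
      have := sq0 (k%:R * U - M%:~R / 6); have := sq0 (k%:R * W - N%:~R / 2).
      by rewrite key; lra.
    by rewrite pmulr_rgt0 // => lt; split; [lra|move=> e; exfalso; lra].
  have E : 8 * k%:R * (9 - k%:R) = 3 * (M%:~R ^+ 2 + 3 * N%:~R ^+ 2) :> R.
    by move: H; rewrite !inE => /or4P[|||/or4P[]] /eqP[-> -> ->]; lra.
  split.
    have : 0 <= k%:R * (2 / 3 - (k%:R * q + (U * M%:~R + W * N%:~R) / 3)).
      have := sq0 (k%:R * U - M%:~R / 6); have := sq0 (k%:R * W - N%:~R / 2).
      by rewrite key E; lra.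
    by rewrite pmulr_rge0 //; lra.
  move=> e; exists (k, M, N) => //=; move: key; rewrite e E.
  have a0 := sq0 (k%:R * U - M%:~R / 6); have b0 := sq0 (k%:R * W - N%:~R / 2).
  move=> key; have /eqP : (k%:R * U - M%:~R / 6) ^+ 2 = 0 by lra.
  have /eqP : (k%:R * W - N%:~R / 2) ^+ 2 = 0 by lra.
  by rewrite !sqrf_eq0 => /eqP h1 /eqP h2; split; lra.
move=> /andP[H1 H2]; rewrite big_cons /=.
case: (leP (q + (U * m%:~R + W * n%:~R) / 3) 0) => _.
  by rewrite add0r; exact: IH.
have := IH _ _ _ H1; rewrite -(addn1 k) natrD !intrD.
set s1 := _ + _ + _; set s2 := _ + _ + _.
suff -> : s1 = s2 by [].
by rewrite /s1 /s2; field.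
Qed.

(** The list [nine_points] runs cell by cell, in the order of the nested sum, so the two sums agree
    term by term. *)
Lemma nine_points_sum y : let s := \sum_(j < 3) \sum_(i < 3) cut y (S_ j (vertex R i)) in
  s <= 2 / 3 /\ (s = 2 / 3 -> exists2 e, e \in extremal &
    (cx y - 1 / 2) * (6 * e.1.1%:R) = e.1.2%:~R /\
    (cy y - 1 / 2) * (2 * e.1.1%:R) = e.2%:~R).
Proof.
have := check_subsets_sum (cx y - 1 / 2) (cy y - 1 / 2) check_nine_points.
cbv zeta; set s1 := _ + _ + _; set s2 := \sum_(j < 3) _.
suff -> : s1 = s2 by [].
rewrite /s1 /s2 /nine_points !big_cons big_nil !big_ord_recl !big_ord0 /=.
rewrite /cut !gainE !cx_S !cy_S !cx_vertex !cy_vertex /=.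
rewrite !mulr0z !mulr0 !addr0 !mul0r !add0r -!addrA.
do 8?[congr (_ + _)]; congr (Num.max _ _); by field.
Qed.

Definition sub_center j : plane R := S_ j (centroid R).

(* The midpoint of the centers of the two cells other than cell [j]. *)
Definition mid_center j : plane R :=
  ((3 * (centroid R).1 - (sub_center j).1) / 2,
   (3 * (centroid R).2 - (sub_center j).2) / 2).

Lemma cx_mid_center j : cx (mid_center j) = (3 / 2 - cx (sub_center j)) / 2.
Proof. by rewrite /cx /=; field. Qed.

Lemma cy_mid_center j : cy (mid_center j) = (3 / 2 - cy (sub_center j)) / 2.
Proof.
have := cy_centroid R; rewrite /cy /= => h.
by rewrite mulrA mulrBr !mulrA ![_ * 3]mulrC -!mulrA h; field.
Qed.

(** The equations say that [y] is the mean of the selected points, which fill three, one or two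
    whole cells. *)
Lemma extremal_centers y :
  (exists2 e, e \in extremal &
    (cx y - 1 / 2) * (6 * e.1.1%:R) = e.1.2%:~R /\
    (cy y - 1 / 2) * (2 * e.1.1%:R) = e.2%:~R) ->
  y = centroid R \/ exists j, y = sub_center j \/ y = mid_center j.
Proof.
move=> [e]; rewrite !inE => /or4P[|||/or4P[]] /eqP -> /= [hx hy].
- by left; apply: eq_plane; rewrite ?cx_centroid ?cy_centroid; lra.
- by right; exists ord0; left; apply: eq_plane;
    rewrite ?cx_S ?cy_S ?cx_centroid ?cy_centroid ?cx_vertex ?cy_vertex /=; lra.
- by right; exists (lift ord0 ord0); left; apply: eq_plane;
    rewrite ?cx_S ?cy_S ?cx_centroid ?cy_centroid ?cx_vertex ?cy_vertex /=; lra.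
- by right; exists (lift ord0 (lift ord0 ord0)); left; apply: eq_plane;
    rewrite ?cx_S ?cy_S ?cx_centroid ?cy_centroid ?cx_vertex ?cy_vertex /=; lra.
- by right; exists ord0; right; apply: eq_plane;
    rewrite ?cx_mid_center ?cy_mid_center ?cx_S ?cy_S ?cx_centroid ?cy_centroid
      ?cx_vertex ?cy_vertex /=; lra.
- by right; exists (lift ord0 ord0); right; apply: eq_plane;
    rewrite ?cx_mid_center ?cy_mid_center ?cx_S ?cy_S ?cx_centroid ?cy_centroid
      ?cx_vertex ?cy_vertex /=; lra.
- by right; exists (lift ord0 (lift ord0 ord0)); right; apply: eq_plane;
    rewrite ?cx_mid_center ?cy_mid_center ?cx_S ?cy_S ?cx_centroid ?cy_centroid
      ?cx_vertex ?cy_vertex /=; lra.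
Qed.

End Gain.

(** * Cells served by a point, and points near the triangle *)

Section Serving.
Context (R : realType).
Implicit Types (x y z : plane R) (i j k : 'I_3) (K : pred 'I_3).

(* Inside the triangle, a point [y] of this kind has positive gain exactly on
   the cells [j] with [K j]. *)
Definition serves y K := exists2 e : R, 0 < e &
  forall j x, triangle x ->
    if K j then e <= gain y (S_ j x) else gain y (S_ j x) <= - e.

Definition far y := forall i, gain y (vertex R i) < 0.

Lemma convex_sum_le (F : 'I_3 -> R) c x : triangle x ->
  (forall i, F i <= c) -> \sum_(i < 3) bary i x * F i <= c.
Proof.
move=> Tx Fc; rewrite -[c]mul1r -(bary_sum x).
apply: le_trans (_ : \sum_(i < 3) bary i x * c <= _).
  by apply: ler_sum => i _; rewrite ler_wpM2l.
by rewrite !big_ord_recl big_ord0 addr0 !mulrDl addrA.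
Qed.

Lemma far_gain y : far y ->
  exists2 e : R, 0 < e & forall x, triangle x -> gain y x <= - e.
Proof.
move=> fy; pose m := \big[Num.max/gain y (vertex R ord0)]_i gain y (vertex R i).
have m0 : m < 0 by rewrite /m; elim/big_ind: _ => // a b a0 b0; rewrite gt_max a0.
exists (- m); first by rewrite oppr_gt0.
move=> x Tx; rewrite opprK gain_bary0; apply: convex_sum_le => // i.
by rewrite /m; exact: le_bigmax.
Qed.

(** The gain is affine, so its sign on a cell can be read off at the vertices; the least absolute
    value there is a uniform margin. *)
Lemma serves_vertices y K :
  (forall j i, if K j then 0 < gain y (S_ j (vertex R i))
               else gain y (S_ j (vertex R i)) < 0) -> serves y K.
Proof.
move=> H; pose e := \big[Num.min/1]_j \big[Num.min/1]_i
  `|gain y (S_ j (vertex R i))|.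
have e_gt0 : 0 < e.
  rewrite /e; elim/big_ind: _ => //.
    by move=> a b a0 b0; rewrite lt_min a0.
  move=> j _; elim/big_ind: _ => //.
    by move=> a b a0 b0; rewrite lt_min a0.
  by move=> i _; have := H j i; case: (K j) => h;
    rewrite normr_gt0; apply/eqP => h0; move: h; rewrite h0 ltxx.
have e_le j i : e <= `|gain y (S_ j (vertex R i))|.
  apply: (@le_trans _ _ (\big[Num.min/1]_i `|gain y (S_ j (vertex R i))|)).
    by rewrite /e; exact: bigmin_le_cond.
  exact: bigmin_le_cond.
exists e => // j x Tx; rewrite gain_bary; have := H j; case: (K j) => Hj.
  rewrite -lerN2 -sumrN.
  under eq_bigr do rewrite -mulrN.
  apply: convex_sum_le => // i; rewrite lerN2.
  by have := e_le j i; rewrite gtr0_norm.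
apply: convex_sum_le => // i.
by have := e_le j i; rewrite ltr0_norm // lerNr.
Qed.

Lemma far_serves y : far y -> serves y pred0.
Proof.
move=> /far_gain[e e0 h]; exists e => // j x /(triangle_S j).
exact: h.
Qed.

Lemma centroid_serves : serves (centroid R) predT.
Proof.
apply: serves_vertices => j i /=; rewrite gainE cx_centroid cy_centroid.
lra.
Qed.

Lemma sub_center_serves j : serves (sub_center R j) (pred1 j).
Proof.
apply: serves_vertices => k i.
rewrite gainE !cx_S !cy_S cx_centroid cy_centroid !cx_vertex !cy_vertex.
by elim/ord3P: j; elim/ord3P: k; elim/ord3P: i => /=; lra.
Qed.

Lemma mid_center_serves j : serves (mid_center R j) (predC1 j).
Proof.
apply: serves_vertices => k i.
rewrite gainE cx_mid_center cy_mid_center !cx_S !cy_S cx_centroid cy_centroid.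
rewrite !cx_vertex !cy_vertex.
by elim/ord3P: j; elim/ord3P: k; elim/ord3P: i => /=; lra.
Qed.

Lemma far_gain_lt0 y x : far y -> triangle x -> gain y x < 0.
Proof. by move=> /far_gain[e e0 h] /h; lra. Qed.

(* The square root of [11/27] is less than [16/25]; this is where the constants
   [3/4] and [57/25 = 1 + 2 * 16/25] of the next lemmas come from. *)
Lemma near_vertex y : ~ far y ->
  exists i, dist2 y (vertex R i) <= 11 / 27.
Proof.
move=> /existsNP[i /negP]; rewrite -leNgt => h; exists i.
(* A vertex is at squared distance [1 / 3] from the centroid, and [2 / 27 + 1 / 3 = 11 / 27]. *)
by move: h; rewrite gainE /dist2 !cx_vertex !cy_vertex; elim/ord3P: i => /=; lra.
Qed.

Lemma bary_vertex k i : bary k (vertex R i) = (k == i)%:R.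
Proof.
rewrite /bary cx_vertex cy_vertex.
by elim/ord3P: k; elim/ord3P: i => /=; lra.
Qed.

(** Cauchy-Schwarz: the gradient of a barycentric coordinate is the inverse of the altitude, of
    square [4 / 3]. *)
Lemma bary_sqr_le k y z : (bary k y - bary k z) ^+ 2 <= 4 / 3 * dist2 y z.
Proof.
rewrite /bary /dist2; set a := cx y; set b := cy y; set c := cx z; set d := cy z.
have h1 := sqr_ge0 (a - c - (b - d)); have h2 := sqr_ge0 (a - c + (b - d)).
have h3 := sqr_ge0 (a - c).
by elim/ord3P: k => /=; lra.
Qed.

(** As above: the difference of two distinct coordinates has a gradient of length 2. *)
Lemma bary_sub_sqr_le j k y z :
  (bary j y - bary k y - (bary j z - bary k z)) ^+ 2 <= 4 * dist2 y z.
Proof.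
rewrite /bary /dist2; set a := cx y; set b := cy y; set c := cx z; set d := cy z.
have h1 := sqr_ge0 (3 * (a - c) + (b - d)).
have h2 := sqr_ge0 (3 * (a - c) - (b - d)).
have h3 := sqr_ge0 (a - c); have h4 := sqr_ge0 (b - d).
by elim/ord3P: k; elim/ord3P: j => /=; lra.
Qed.

Lemma near_bary y k : ~ far y -> - (3 / 4) <= bary k y.
Proof.
move=> /near_vertex[i h]; rewrite leNgt; apply/negP => lt.
have := bary_sqr_le k y (vertex R i); rewrite bary_vertex.
by case: (k == i) => /= h1; nra.
Qed.

Lemma near_bary_sub y j k : ~ far y -> bary j y - bary k y <= 57 / 25.
Proof.
move=> /near_vertex[i h]; rewrite leNgt; apply/negP => lt.
have := bary_sub_sqr_le j k y (vertex R i); rewrite !bary_vertex.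
have : (j == i)%:R - (k == i)%:R <= 1 :> R.
  by case: (j == i); case: (k == i) => /=; lra.
set t := _ - _ => t1 h1; nra.
Qed.

(** The constant is [(2 - 3 / 4) / 3]. Three times it exceeds 1, so no point is near all three
    cells. *)
Lemma near_inv_bary a j : ~ far (S_inv j a) -> 5 / 12 <= bary j a.
Proof.
by move=> n; have := near_bary j n; rewrite bary_S_inv eqxx /=; lra.
Qed.

End Serving.

(** * The dual bound at level l *)

Section Words.
Context (R : realType).
Implicit Types (x y a : plane R) (j : 'I_3).

(** The first letter is the outermost map, hence undone first: a left fold. Plain sequences make
    inductions on [w] independent of the length. *)
Definition S_word_inv (w : seq 'I_3) a : plane R :=
  foldl (fun b j => S_inv j b) a w.

Lemma sum_word0 (V : nmodType) (F : seq 'I_3 -> V) :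
  \sum_(w : word 0) F w = F [::].
Proof.
rewrite (bigD1 [tuple]) //= big1 ?addr0 // => w /negP[].
by apply/eqP; exact: tuple0.
Qed.

Lemma sum_wordS (V : nmodType) l (F : seq 'I_3 -> V) :
  \sum_(w : word l.+1) F w = \sum_(j < 3) \sum_(w : word l) F (j :: w).
Proof.
rewrite pair_big /=.
rewrite (reindex (fun p : 'I_3 * word l => [tuple of p.1 :: p.2])) //=.
exists (fun w : word l.+1 => (thead w, [tuple of behead w])) => [[j w] _|w _] /=.
  by congr (_, _); apply: val_inj.
by apply: val_inj; rewrite /= [in RHS](tuple_eta w).
Qed.

Lemma dist2_S_word (w : seq 'I_3) x a :
  dist2 (foldr (fun j f => @S_ R j \o f) id w x) a =
  dist2 x (S_word_inv w a) / 9 ^+ size w.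
Proof.
elim: w a => [|j w IH] a /=; first by rewrite divr1.
by rewrite dist2_S IH exprSr invfM; ring.
Qed.

Lemma near_word_bary (w : seq 'I_3) a k : ~ far (S_word_inv w a) ->
  - (3 / 4) <= bary k a.
Proof.
elim: w a => [|j w IH] a /=; first exact: near_bary.
by move=> /IH; rewrite bary_S_inv; case: (k == j) => /=; lra.
Qed.

(** Below the first level, nearness to a subcell of cell [k] forces the [k]-th coordinate to be at
    least [7 / 12] and the others at least [- 1 / 12]. Two different first letters would give a
    total of [13 / 12 > 1]. *)
Lemma near_words_head a i j (v w : seq 'I_3) : (0 < size v)%N -> (0 < size w)%N ->
  ~ far (S_word_inv v (S_inv i a)) -> ~ far (S_word_inv w (S_inv j a)) -> i = j.
Proof.
have H k (u : seq 'I_3) m : (0 < size u)%N -> ~ far (S_word_inv u (S_inv k a)) ->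
    2 / 3 * (m == k)%:R - 1 / 12 <= bary m a.
  case: u => //= i' u _ n.
  have := near_word_bary m n; rewrite !bary_S_inv.
  by case: (m == i'); case: (m == k) => /=; lra.
move=> v0 w0 nv nw; apply/eqP; apply/negP => ij.
have hv m := H _ _ m v0 nv; have hw m := H _ _ m w0 nw.
have := bary_sum a.
have := hv ord0; have := hv (lift ord0 ord0).
have := hv (lift ord0 (lift ord0 ord0)).
have := hw ord0; have := hw (lift ord0 ord0).
have := hw (lift ord0 (lift ord0 ord0)).
by move: ij; clear H hv hw nv nw; elim/ord3P: i; elim/ord3P: j => //= _; lra.
Qed.

End Words.

(** * Bounds for [phi] and for its sum over the cells of a level *)

Section Phi.
Context (R : realType) (P : probability (plane R) R).
Hypothesis P_self_similar : self_similar P.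
Implicit Types (x y z a : plane R) (i j k : 'I_3).

Definition phi y : R := mean P (cut y).

Lemma far_phi y : far y -> phi y = 0.
Proof.
move=> fy; rewrite -[RHS](mean_cst P_self_similar 0); apply: eq_mean => x Tx.
by rewrite /cut max_r // ltW // far_gain_lt0.
Qed.

(* [P] is dominated in the convex order by the uniform measure on the nine
   vertices of the cells. *)
Lemma phi_le_nine y :
  phi y <= 1 / 9 * \sum_(j < 3) \sum_(i < 3) cut y (S_ j (vertex R i)).
Proof.
have tb i : tame (fun x => cut y (S_ i x)) by exact: (tame_S i (tame_cut y)).
have H j : mean P (fun x => cut y (S_ j x)) <=
    1 / 3 * \sum_(i < 3) cut y (S_ j (vertex R i)).
  (* Over a cell a convex function lies below its barycentric interpolation, and each coordinate has
     mean one third. *)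
  have -> : 1 / 3 * \sum_(i < 3) cut y (S_ j (vertex R i)) =
      mean P (fun x => \sum_(i < 3) cut y (S_ j (vertex R i)) * bary i x).
    rewrite mean_sum //; last first.
      by move=> i; apply: tameM; [exact: tame_cst|exact: tame_bary].
    rewrite mulr_sumr; apply: eq_bigr => i _.
    by rewrite meanZ // ?mean_bary // 1?mulrC //; exact: tame_bary.
  apply: le_mean => //.
    by apply: tame_sum => i; apply: tameM; [exact: tame_cst|exact: tame_bary].
  move=> x Tx; rewrite {1}/cut ge_max; apply/andP; split.
    rewrite gain_bary; apply: ler_sum => i _; rewrite mulrC.
    by apply: ler_wpM2r => //; exact: gain_le_cut.
  by apply: sumr_ge0 => i _; apply: mulr_ge0 => //; exact: cut_ge0.
rewrite /phi (mean_self_similar P_self_similar (tame_cut y)).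
rewrite (_ : 1 / 9 = 1 / 3 * (1 / 3)); last by field.
rewrite -[leRHS]mulrA ler_pM2l // mulr_sumr.
exact: ler_sum.
Qed.

Lemma phi_le y : phi y <= 2 / 27.
Proof.
have [h _] := nine_points_sum y; have := phi_le_nine y; lra.
Qed.

Lemma phi_eq y : phi y = 2 / 27 ->
  y = centroid R \/ exists j, y = sub_center R j \/ y = mid_center R j.
Proof.
move=> e; apply: extremal_centers; have [h1 h2] := nine_points_sum y.
by apply: h2; have := phi_le_nine y; rewrite e; lra.
Qed.

(** If a point is near both cells [j] and [k], its preimage [y] under [S_ j] satisfies the
    hypothesis, with [43 / 25 = 4 - 57 / 25]. Then among the nine points only vertex [k] can have
    positive gain, at most [7 / 25], and [7 / 225 < 1 / 27]. *)
Lemma phi_lt_half y j k : j != k -> bary j y - bary k y <= - (43 / 25) ->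
  phi y < 1 / 27.
Proof.
move=> jk lt.
have dist2C (u v : plane R) : dist2 u v = dist2 v u by rewrite /dist2; ring.
(* The distance of [y] and [p] is bounded below by [bary_sub_sqr_le]; squaring is monotone here
   because [43 / 25 + t] is positive. *)
have gainC i l : let p := S_ i (vertex R l) in
    gain y p <= 2 / 27 + dist2 p (centroid R) -
      (43 / 25 + (bary j p - bary k p)) ^+ 2 / 4.
  move=> p; rewrite /gain (dist2C p y).
  have := bary_sub_sqr_le j k y p.
  have : -1 <= bary j p - bary k p.
    rewrite /p !bary_S !bary_vertex.
    by case: (j == l); case: (j == i); case: (k == l); case: (k == i) => /=; lra.
  set t := bary j p - bary k p => t1 h.
  suff : (43 / 25 + t) ^+ 2 <= (bary j y - bary k y - t) ^+ 2 by lra.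
  by nra.
have bound i l : cut y (S_ i (vertex R l)) <=
    if (i == k) && (l == k) then 7 / 25 else 0.
  have := gainC i l; rewrite /= !bary_S !bary_vertex /dist2 cx_centroid cy_centroid.
  rewrite cx_S cy_S !cx_vertex !cy_vertex /cut ge_max => h.
  apply/andP; split; last by case: ifP => _; lra.
  apply: le_trans h _; clear lt gainC; move: jk.
  by elim/ord3P: j; elim/ord3P: k => //= _; elim/ord3P: i; elim/ord3P: l => /=; lra.
apply: le_lt_trans (phi_le_nine y) _.
apply: (@le_lt_trans _ _ (1 / 9 * (7 / 25))); last lra.
rewrite ler_pM2l //.
apply: le_trans (_ : \sum_(i < 3) \sum_(l < 3)
    (if (i == k) && (l == k) then 7 / 25 else 0) <= _).
  by apply: ler_sum => i _; apply: ler_sum.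
rewrite !big_ord_recl !big_ord0; clear bound lt gainC jk; elim/ord3P: k => /=; lra.
Qed.

(** Either at most one cell matters, and [phi_le] applies to it, or the bound is strict, which
    excludes [a] from the case of equality. *)
Lemma word_dichotomy l a :
  (exists w : word l, forall w' : word l, w' != w -> far (S_word_inv w' a)) \/
  \sum_(w : word l) phi (S_word_inv w a) < 2 / 27.
Proof.
elim: l a => [|[|l] IH] a.
- by left; exists [tuple] => w' /negP[]; apply/eqP; exact: tuple0.
(* Level one: three near cells are impossible, and with two near cells each term is less than
   [1 / 27]. *)
- pose y j := S_inv j a.
  have half i j : i != j -> ~ far (y i) -> ~ far (y j) -> phi (y i) < 1 / 27.
    move=> ij ni nj; apply: (phi_lt_half ij).
    have := near_bary_sub i j nj; rewrite !bary_S_inv eqxx [j == i]eq_sym (negbTE ij) /=.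
    by rewrite eqxx /=; lra.
  have three : ~ far (y ord0) -> ~ far (y (lift ord0 ord0)) ->
      ~ far (y (lift ord0 (lift ord0 ord0))) -> False.
    move=> /near_inv_bary h0 /near_inv_bary h1 /near_inv_bary h2.
    by have := bary_sum a; lra.
  have one j : (forall i, i != j -> far (y i)) ->
    exists w : word 1, forall w' : word 1, w' != w -> far (S_word_inv w' a).
    move=> H; exists [tuple j] => w'; case/tupleP: w' => i w'; rewrite (tuple0 w').
    move=> ij; apply: H; apply: contraNneq ij => ->.
    by apply/eqP; apply: val_inj.
  rewrite (sum_wordS _ (fun w => phi (S_word_inv w a))).
  under eq_bigr => j _ do
    rewrite (sum_word0 (fun w => phi (S_word_inv (j :: w) a))).
  rewrite !big_ord_recl big_ord0 addr0 /= -!/(y _).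
  set i0 : 'I_3 := ord0; set i1 : 'I_3 := lift ord0 ord0.
  set i2 : 'I_3 := lift ord0 (lift ord0 ord0).
  have [f0|n0] := pselect (far (y i0)); have [f1|n1] := pselect (far (y i1));
    have [f2|n2] := pselect (far (y i2)).
  + by left; apply: (one i0); elim/ord3P.
  + by left; apply: (one i2); elim/ord3P.
  + by left; apply: (one i1); elim/ord3P.
  + right; rewrite (far_phi f0).
    by have := half i1 i2 isT n1 n2; have := half i2 i1 isT n2 n1; lra.
  + by left; apply: (one i0); elim/ord3P.
  + right; rewrite (far_phi f1).
    by have := half i0 i2 isT n0 n2; have := half i2 i0 isT n2 n0; lra.
  + right; rewrite (far_phi f2).
    by have := half i0 i1 isT n0 n1; have := half i1 i0 isT n1 n0; lra.
  + by exfalso; exact: three.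
(* From level two on, all near cells share their first letter, by [near_words_head]; the induction
   hypothesis is used inside that cell. *)
- have [[j [w nw]]|H] :=
    pselect (exists j (w : word l.+1), ~ far (S_word_inv w (S_inv j a))).
    have other i (w' : word l.+1) : i != j -> far (S_word_inv w' (S_inv i a)).
      move=> ij; apply: contrapT => n; move/eqP: ij; apply.
      by apply: (near_words_head _ _ n nw); rewrite size_tuple.
    have [[u Hu]|lt] := IH (S_inv j a).
      left; exists [tuple of j :: u] => w'; case/tupleP: w' => i w' /= ne.
      have [ij|ij] := eqVneq i j; last exact: other.
      rewrite ij; apply: Hu; apply: contraNneq ne => ->.
      by apply/eqP; apply: val_inj; rewrite /= ij.
    right; rewrite (sum_wordS _ (fun w => phi (S_word_inv w a))) (bigD1 j) //=.
    rewrite [X in _ + X]big1 ?addr0 //.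
    by move=> i ij; apply: big1 => w' _; rewrite far_phi //; exact: other.
  (* No cell is near, so any word serves as the exception. *)
  left; exists [tuple of nseq l.+2 ord0] => w' _; case/tupleP: w' => i w' /=.
  by apply: contrapT => n; apply: H; exists i, w'.
Qed.

Lemma sum_word_phi_le l a : \sum_(w : word l) phi (S_word_inv w a) <= 2 / 27.
Proof.
have [[w Hw]|/ltW //] := word_dichotomy l a.
rewrite (bigD1 w) //= big1 ?addr0 ?phi_le // => w' ne.
by rewrite far_phi //; exact: Hw.
Qed.

End Phi.

(** * Finite point sets and nearest points *)

Section NearestPoint.
Context (R : realType).
Implicit Types (x y a : plane R) (s : seq (plane R)) (j : 'I_3).

Lemma dist2_ge0 x y : 0 <= dist2 x y.
Proof. by rewrite addr_ge0 ?divr_ge0 ?sqr_ge0. Qed.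

(** A recursive minimum starting from the head [a]: measurability and attainment of the infimum
    become inductions. *)
Let nearest x a s : R := foldr (fun b m => Num.min (dist2 x b) m) (dist2 x a) s.

Let nearest_mem x a s : exists2 b, b \in a :: s & nearest x a s = dist2 x b.
Proof.
elim: s => [|b s [c cs IH]] /=; first by exists a; rewrite ?mem_head.
case: leP => _; first by exists b; rewrite // !inE eqxx orbT.
by exists c => //; move: cs; rewrite !inE => /orP[->|->]; rewrite ?orbT.
Qed.

Let nearest_le x a s b : b \in a :: s -> nearest x a s <= dist2 x b.
Proof.
elim: s => [|c s IH] /=; first by rewrite inE => /eqP ->.
rewrite !inE ge_min orbCA => /orP[/eqP ->|H]; first by rewrite lexx.
by rewrite IH ?orbT // inE.
Qed.

Let sqdist_nearest x a s : sqdist x [set` a :: s] = nearest x a s.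
Proof.
rewrite /sqdist; set D := [set _ | _ in _].
have [b bs bE] := nearest_mem x a s.
have Db : D (nearest x a s) by exists b => //; rewrite euclidean_norm_dist2 bE.
have lbD : lbound D (nearest x a s).
  by move=> _ [c cs <-]; rewrite euclidean_norm_dist2; exact: nearest_le.
apply/eqP; rewrite eq_le; apply/andP; split.
  by apply: ge_inf => //; exists (nearest x a s).
by apply: lb_le_inf => //; exists (nearest x a s).
Qed.

Lemma sqdist_le s x a : a \in s -> sqdist x [set` s] <= dist2 x a.
Proof. by case: s => // b s; rewrite sqdist_nearest; exact: nearest_le. Qed.

Lemma sqdist_mem s x : s != [::] ->
  exists2 a, a \in s & sqdist x [set` s] = dist2 x a.
Proof. by case: s => // b s _; rewrite sqdist_nearest; exact: nearest_mem. Qed.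

Lemma tame_sqdist s : s != [::] -> tame (fun x => sqdist x [set` s]).
Proof.
case: s => // a s _; rewrite (_ : (fun _ => _) = fun x => nearest x a s).
  elim: s => [|b s IH] /=; first exact: tame_dist2.
  by apply: tame_min => //; exact: tame_dist2.
by apply/funext => x; exact: sqdist_nearest.
Qed.

Lemma sqdist_ge0 s x : s != [::] -> 0 <= sqdist x [set` s].
Proof. by move=> /(sqdist_mem x)[a _ ->]; exact: dist2_ge0. Qed.

Definition S_seq (w : seq 'I_3) : plane R -> plane R :=
  foldr (fun j f => @S_ R j \o f) id w.

Lemma sqdist_S_seq (w : seq 'I_3) s x : s != [::] ->
  sqdist (S_seq w x) [set` s] =
  sqdist x [set` map (S_word_inv w) s] / 9 ^+ size w.
Proof.
move=> s0; have ms0 : map (S_word_inv w) s != [::] by case: s s0.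
have p9 : 0 < (9 ^+ size w)^-1 :> R by rewrite invr_gt0 exprn_gt0.
apply/eqP; rewrite eq_le; apply/andP; split.
  have [_ /mapP[a as_ ->] ->] := sqdist_mem x ms0.
  by rewrite -dist2_S_word; exact: sqdist_le.
have [a as_ ->] := sqdist_mem (S_seq w x) s0.
by rewrite dist2_S_word ler_pM2r // sqdist_le // map_f.
Qed.

Lemma card_le_seq s n : (size s <= n)%N -> ([set` s] #<= `I_n)%card.
Proof.
move=> sn; apply: card_le_trans (_ : (`I_(size s) #<= `I_n)%card).
  apply: card_le_trans (card_image_le (nth (0, 0) s) _).
  apply: subset_card_le => x /= xs; exists (index x s); first by rewrite /= index_mem.
  exact: nth_index.
by rewrite card_le_II.
Qed.

Lemma codebookP n (A : set (plane R)) : codebook n A ->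
  exists s, [/\ uniq s, s != [::], A = [set` s] & (size s <= n)%N].
Proof.
move=> [[a Aa] An].
have /finite_fsetP[X AX] : finite_set A by apply/finite_set_leP; exists n.
exists (enum_fset X); split=> //; first exact: fset_uniq.
  apply/eqP => X0; have : a \in enum_fset X by move: Aa; rewrite AX.
  by rewrite X0.
have /card_eq_fsetP XE : #|` X| = #|` X| by [].
have /card_eqPle[_ leX] := XE.
by rewrite -card_le_II; apply: card_le_trans An; rewrite AX.
Qed.

End NearestPoint.

(** * The lower bound for the distortion *)

Section LowerBound.
Context (R : realType) (P : probability (plane R) R).
Hypothesis P_self_similar : self_similar P.
Implicit Types (x y a : plane R) (s : seq (plane R)) (j : 'I_3).

Lemma mean_word l (h : plane R -> R) : tame h ->
  mean P h = (3 ^+ l)^-1 * \sum_(w : word l) mean P (fun x => h (S_seq w x)).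
Proof.
elim: l h => [|l IH] h th.
  by rewrite (sum_word0 (fun w => mean P (fun x => h (S_seq w x)))) expr0 invr1 mul1r.
rewrite (mean_self_similar P_self_similar th).
rewrite (sum_wordS _ (fun w => mean P (fun x => h (S_seq w x)))).
under eq_bigr => j _ do rewrite (IH _ (tame_S j th)).
by rewrite -mulr_sumr mulrA exprS invfM div1r.
Qed.

(** The parallel axis theorem. The variance [m] solves [m = (m + 4 / 3) / 9], since [S_inv j] moves
    the centroid by twice its distance to vertex [j]. *)
Lemma mean_dist2 y : mean P (fun x => dist2 x y) = 1 / 6 + dist2 (centroid R) y.
Proof.
have aff c d : mean P (fun x => c * (cx x - 1 / 2) + d * (cy x - 1 / 2)) = 0.
  transitivity (mean P (fun x => c * (bary (lift ord0 ord0) x - 1 / 3) +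
      (c + 3 * d) / 2 * (bary (lift ord0 (lift ord0 ord0)) x - 1 / 3))).
    by apply: eq_mean => x _; rewrite /bary /=; field.
  have tB i : tame (fun x : plane R => bary i x - 1 / 3).
    by apply: tameB; [exact: tame_bary|exact: tame_cst].
  have mB i : mean P (fun x => bary i x - 1 / 3) = 0.
    rewrite meanB //; [|exact: tame_bary|exact: tame_cst].
    by rewrite mean_bary // mean_cst // subrr.
  have tc i (c' : R) : tame (fun x : plane R => c' * (bary i x - 1 / 3)).
    by apply: tameM => //; exact: tame_cst.
  by rewrite meanD // !meanZ // !mB !mulr0 addr0.
have tlin c d : tame (fun x : plane R => c * (cx x - 1 / 2) + d * (cy x - 1 / 2)).
  apply: tameD; apply: tameM; try exact: tame_cst; apply: tameB; try exact: tame_cst.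
    exact: tame_cx.
  exact: tame_cy.
have center z : mean P (fun x => dist2 x z) =
    mean P (fun x => dist2 x (centroid R)) + dist2 (centroid R) z.
  rewrite -[X in _ + X](mean_cst P_self_similar) -meanD //;
    [|exact: tame_dist2|exact: tame_cst].
  (* The coefficients are those of the cross term, which has mean zero. *)
  rewrite -[RHS]addr0 -(aff (1 - 2 * cx z) (1 / 3 - 2 / 3 * cy z)) -meanD //; last first.
    by apply: tameD; [exact: tame_dist2|exact: tame_cst].
  by apply: eq_mean => x _; rewrite /dist2 cx_centroid cy_centroid; field.
rewrite center; congr (_ + _).
have : mean P (fun x => dist2 x (centroid R)) = 1 / 3 * \sum_(j < 3) (9^-1 *
    (mean P (fun x => dist2 x (centroid R)) +
     dist2 (centroid R) (S_inv j (centroid R)))).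
  rewrite {1}(mean_self_similar P_self_similar (tame_dist2 (centroid R))).
  congr (_ * _); apply: eq_bigr => j _; rewrite -center -meanZ //; last exact: tame_dist2.
  by apply: eq_mean => x _; rewrite dist2_S mulrC.
rewrite !big_ord_recl big_ord0 /dist2 cx_centroid cy_centroid.
rewrite !cx_S_inv !cy_S_inv cx_centroid cy_centroid !cx_vertex !cy_vertex /=.
set m := mean _ _; lra.
Qed.

Definition distort s : R := mean P (fun x => sqdist x [set` s]).

Lemma distortionE s : s != [::] -> distortion P [set` s] = (distort s)%:E.
Proof.
move=> s0; apply: integral_mean => //; first exact: tame_sqdist.
by move=> x; exact: sqdist_ge0.
Qed.

Lemma distort_word l s : s != [::] -> distort s =
  (27 ^+ l)^-1 * \sum_(w : word l) distort (map (S_word_inv w) s).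
Proof.
move=> s0; rewrite /distort (mean_word l (tame_sqdist s0)).
(* A cell contributes the factor 3 for its mass and 9 for squared distances. *)
rewrite (_ : 27 = 3 * 9); last by rewrite -natrM.
rewrite exprMn invfM -mulrA; congr (_ * _); rewrite mulr_sumr.
apply: eq_bigr => w _; rewrite -meanZ //; last by apply: tame_sqdist; case: (s) s0.
by apply: eq_mean => x _; rewrite sqdist_S_seq // size_tuple mulrC.
Qed.

(** The largest gain among the points of [s]. Its mean is [V_1 + 2 / 27] minus the distortion, where
    [V_1 = 1 / 6]. *)
Definition top_gain s x : R := 2 / 27 + dist2 x (centroid R) - sqdist x [set` s].

Lemma tame_top_gain s : s != [::] -> tame (top_gain s).
Proof.
move=> s0; apply: tameB; last exact: tame_sqdist.
by apply: tameD; [exact: tame_cst|exact: tame_dist2].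
Qed.

Lemma mean_top_gain s : s != [::] -> mean P (top_gain s) = 13 / 54 - distort s.
Proof.
move=> s0; rewrite /top_gain meanB //; last exact: tame_sqdist.
  rewrite meanD //; [|exact: tame_cst|exact: tame_dist2].
  rewrite mean_cst // mean_dist2 /dist2 /distort !subrr expr0n /= mul0r; lra.
by apply: tameD; [exact: tame_cst|exact: tame_dist2].
Qed.

Lemma top_gain_mem s x : s != [::] -> exists2 a, a \in s & top_gain s x = gain a x.
Proof. by move=> /(sqdist_mem x)[a sa e]; exists a; rewrite // /top_gain e. Qed.

Lemma sum_cut_ge s x a : a \in s -> cut a x <= \sum_(b <- s) cut b x.
Proof.
by move=> sa; rewrite (big_rem a) //= lerDl sumr_ge0 // => b _; exact: cut_ge0.
Qed.

Lemma top_gain_le s x : s != [::] -> top_gain s x <= \sum_(a <- s) cut a x.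
Proof.
move=> /(top_gain_mem x)[a sa ->].
exact: le_trans (gain_le_cut _ _) (sum_cut_ge _ sa).
Qed.

Lemma tame_sum_cut s : tame (fun x => \sum_(a <- s) cut a x).
Proof. by apply: tame_sum => a; exact: tame_cut. Qed.

Lemma mean_sum_cut s : mean P (fun x => \sum_(a <- s) cut a x) =
  \sum_(a <- s) phi P a.
Proof. by rewrite mean_sum // => a; exact: tame_cut. Qed.

Lemma mean_top_gain_le s : s != [::] ->
  mean P (top_gain s) <= \sum_(a <- s) phi P a.
Proof.
move=> s0; rewrite -mean_sum_cut; apply: le_mean => //.
- exact: tame_top_gain.
- exact: tame_sum_cut.
- by move=> x _; exact: top_gain_le.
Qed.

Lemma sum_top_gain l s : s != [::] ->
  \sum_(w : word l) mean P (top_gain (map (S_word_inv w) s)) =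
  3 ^+ l * (13 / 54) - 27 ^+ l * distort s.
Proof.
move=> s0; under eq_bigr => w _ do
  rewrite mean_top_gain -?size_eq0 ?size_map ?size_eq0 //.
rewrite sumrB (distort_word l s0) mulVKf ?expf_neq0 //.
by rewrite sumr_const card_tuple card_ord -[_ *+ (3 ^ l)]mulr_natl natrX.
Qed.

Lemma sum_phi_exchange l s :
  \sum_(w : word l) \sum_(a <- map (S_word_inv w) s) phi P a =
  \sum_(a <- s) \sum_(w : word l) phi P (S_word_inv w a).
Proof.
by under eq_bigr do rewrite big_map; rewrite exchange_big.
Qed.

Lemma sum_phi_le l s : \sum_(a <- s) \sum_(w : word l) phi P (S_word_inv w a) <=
  2 / 27 * (size s)%:R.
Proof.
rewrite -[(size s)%:R]mulr1 mulrA [_ * _%:R]mulrC -mulrA mulr_natl.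
elim: s => [|a s IH]; first by rewrite big_nil mulr0n.
rewrite big_cons mulrS lerD //.
by rewrite mulr1; exact: sum_word_phi_le.
Qed.

(** In each cell of level [l] the top gain is at most the sum of the cuts. After exchanging the
    sums, each point contributes at most [2 / 27] over all cells. *)
Lemma distort_ge l s : s != [::] ->
  (13 * 3 ^+ l - 4 * (size s)%:R) / (54 * 27 ^+ l) <= distort s.
Proof.
move=> s0; have p : 0 < 27 ^+ l :> R by rewrite exprn_gt0.
rewrite ler_pdivrMr ?mulr_gt0 //.
have := sum_top_gain l s0; have := sum_phi_le l s.
rewrite -sum_phi_exchange.
have : \sum_(w : word l) mean P (top_gain (map (S_word_inv w) s)) <=
    \sum_(w : word l) \sum_(a <- map (S_word_inv w) s) phi P a.
  by apply: ler_sum => w _; apply: mean_top_gain_le; case: (s) s0.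
set A := \sum_(w : _) _; set B := \sum_(w : _) _; move=> h1 h2 h3; nra.
Qed.

End LowerBound.

(** * Equality in the dual bound *)

Section Equality.
Context (R : realType) (P : probability (plane R) R).
Hypothesis P_self_similar : self_similar P.
Implicit Types (x y a b : plane R) (s : seq (plane R)) (j k : 'I_3).

(** A boolean test at the center of cell [j]; when [y] serves a set of cells, it recovers that
    set. *)
Definition hits y j : bool := 0 < gain y (sub_center R j).

Definition prime_site y : Prop :=
  y = centroid R \/ exists j, y = sub_center R j \/ y = mid_center R j.

Lemma centroid_in_triangle : triangle (centroid R).
Proof.
by move=> i; rewrite /bary cx_centroid cy_centroid; elim/ord3P: i => /=; lra.
Qed.

Lemma serves_hits y (K : pred 'I_3) : serves y K -> hits y =1 K.
Proof.
move=> [e e0 H] j; rewrite /hits.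
have := H j _ centroid_in_triangle; rewrite -/(sub_center R j).
case: (K j) => h; first by apply: lt_le_trans h.
by apply/negbTE; rewrite -leNgt; lra.
Qed.

Lemma far_hits y j : far y -> hits y j = false.
Proof. by move=> /far_serves/serves_hits ->. Qed.

Lemma hits_centroid j : hits (centroid R) j.
Proof. by rewrite (serves_hits (centroid_serves R)). Qed.

Lemma hits_sub_center j k : hits (sub_center R j) k = (k == j).
Proof. by rewrite (serves_hits (sub_center_serves R j)). Qed.

Lemma hits_mid_center j k : hits (mid_center R j) k = (k != j).
Proof. by rewrite (serves_hits (mid_center_serves R j)). Qed.

Lemma prime_site_serves y : prime_site y -> serves y (hits y).
Proof.
have H z K : serves z K -> serves z (hits z).
  by move=> sK; rewrite (funext (serves_hits sK)).
move=> [->|[j [->|->]]]; apply: H.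
- exact: centroid_serves.
- exact: sub_center_serves.
- exact: mid_center_serves.
Qed.

Lemma far_serves_hits y : far y -> serves y (hits y).
Proof.
by move=> fy; rewrite (funext (serves_hits (far_serves fy))); exact: far_serves.
Qed.

Lemma serves_uniform s : (forall a, a \in s -> serves a (hits a)) ->
  exists2 e : R, 0 < e & forall a j x, a \in s -> triangle x ->
    if hits a j then e <= gain a (S_ j x) else gain a (S_ j x) <= - e.
Proof.
elim: s => [|b s IH] H; first by exists 1.
have [e1 e10 h1] := H b (mem_head _ _).
have [e2 e20 h2] := IH (fun a as_ => H a (mem_behead (s := b :: s) as_)).
exists (Num.min e1 e2); first by rewrite lt_min e10.
move=> a j x; rewrite inE => /orP[/eqP ->|as_] Tx.
  have := h1 j x Tx; case: (hits b j) => h.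
    by rewrite ge_min h.
  by apply: le_trans h _; rewrite lerN2 ge_min lexx.
have := h2 a j x as_ Tx; case: (hits a j) => h.
  by rewrite ge_min h orbT.
by apply: le_trans h _; rewrite lerN2 ge_min lexx orbT.
Qed.

(** On a cell hit by no point or by several points of [s], the top gain stays below the sum of the
    cuts by a uniform margin, and [lt_mean] makes the inequality strict. *)
Lemma mean_top_gain_eq s : s != [::] ->
  (forall a, a \in s -> serves a (hits a)) ->
  mean P (top_gain s) = \sum_(a <- s) phi P a ->
  forall j, count (hits^~ j) s = 1%N.
Proof.
move=> s0 /serves_uniform[e e0 H] E j; apply/eqP/negP => /negP n1.
suff : mean P (top_gain s) < \sum_(a <- s) phi P a by rewrite E ltxx.
rewrite -mean_sum_cut //; apply: (lt_mean P_self_similar (j := j)) e0 _ _ => //.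
- exact: tame_top_gain.
- exact: tame_sum_cut.
- by move=> x _; exact: top_gain_le.
move=> x Tx; have [a sa aE] := top_gain_mem (S_ j x) s0; rewrite aE.
have Ha := H a j x sa Tx.
(* If the nearest point misses the cell, the top gain is at most [- e], while the sum is
   nonnegative. *)
have [ha|ha] := boolP (hits a j); rewrite ?ha ?(negbTE ha) in Ha; last first.
  apply: le_trans (_ : 0 <= _); first lra.
  by apply: sumr_ge0 => b _; exact: cut_ge0.
(* Otherwise a second entry of [s] hits the cell and adds at least [e] to the sum. *)
have : count (hits^~ j) (rem a s) != 0%N.
  by move: n1; rewrite (permP (perm_to_rem sa)) /= ha add1n eqSS.
rewrite -lt0n -has_count => /hasP[b sb hb].
rewrite (big_rem a) //= lerD ?gain_le_cut //.
apply: le_trans (sum_cut_ge _ sb); apply: le_trans (gain_le_cut _ _).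
by have := H b j x (mem_rem sb) Tx; rewrite hb.
Qed.

(** All inequalities behind [distort_ge] must be equalities, for each point and in each cell
    separately. *)
Lemma distort_eq l s n : s != [::] -> (size s <= n)%N ->
  distort P s <= (13 * 3 ^+ l - 4 * n%:R) / (54 * 27 ^+ l) ->
  [/\ size s = n,
      forall a, a \in s -> exists2 w : word l, prime_site (S_word_inv w a) &
        forall w' : word l, w' != w -> far (S_word_inv w' a)
    & forall (w : word l) j, count (fun a => hits (S_word_inv w a) j) s = 1%N].
Proof.
move=> s0 sn; have p : 0 < 27 ^+ l :> R by rewrite exprn_gt0.
have ms0 (w : word l) : map (S_word_inv w) s != [::] by case: (s) s0.
rewrite ler_pdivlMr ?mulr_gt0 // => D.
have T := sum_top_gain P_self_similar l s0.
have L := sum_phi_le P_self_similar l s.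
have G (w : word l) : mean P (top_gain (map (S_word_inv w) s)) <=
    \sum_(a <- map (S_word_inv w) s) phi P a by exact: mean_top_gain_le.
have GS : \sum_(w : word l) mean P (top_gain (map (S_word_inv w) s)) <=
    \sum_(w : word l) \sum_(a <- map (S_word_inv w) s) phi P a.
  by apply: ler_sum => w _; exact: G.
have X := sum_phi_exchange P l s.
have N : (size s)%:R <= n%:R :> R by rewrite ler_nat.
have sizeE : size s = n by apply/eqP; rewrite -(eqr_nat R); apply/eqP; lra.
(* A deficit at [a] cannot be compensated, as the remaining points obey the same bound. *)
have phiE a : a \in s -> \sum_(w : word l) phi P (S_word_inv w a) = 2 / 27.
  move=> sa; apply/eqP; rewrite eq_le sum_word_phi_le //= leNgt; apply/negP => lt.
  have R1 := sum_phi_le P_self_similar l (rem a s).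
  have S1 : size s = (size (rem a s)).+1.
    by rewrite size_rem // prednK //; case: (s) sa.
  move: L X; rewrite (big_rem a sa) /= => L X.
  have : (size s)%:R = (size (rem a s))%:R + 1 :> R by rewrite S1 -addn1 natrD.
  move: R1 lt T D X GS L; rewrite sizeE.
  set u := \sum_(w : _) _; set v := \sum_(b <- rem a s) _.
  lra.
have GE (w : word l) : mean P (top_gain (map (S_word_inv w) s)) =
    \sum_(a <- map (S_word_inv w) s) phi P a.
  apply/eqP; rewrite eq_le G /= leNgt; apply/negP => lt.
  have : \sum_(w : word l) mean P (top_gain (map (S_word_inv w) s)) <
      \sum_(w : word l) \sum_(a <- map (S_word_inv w) s) phi P a.
    rewrite (bigD1 w) //= [ltRHS](bigD1 w) //=; apply: ltr_leD => //.
    by apply: ler_sum => v _; exact: G.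
  lra.
have site a : a \in s -> exists2 w : word l, prime_site (S_word_inv w a) &
    forall w' : word l, w' != w -> far (S_word_inv w' a).
  move=> sa; have [[w Hw]|] := word_dichotomy P_self_similar l a; last first.
    by rewrite phiE // ltxx.
  exists w => //; apply: (phi_eq P_self_similar); rewrite -(phiE a sa).
  rewrite (bigD1 w) //= [X in _ + X]big1 ?addr0 // => w' ne.
  by rewrite far_phi //; exact: Hw.
split=> // w j.
have := mean_top_gain_eq (ms0 w) _ (GE w) j; rewrite count_map; apply.
move=> _ /mapP[a sa ->]; have [v sv fv] := site a sa.
have [->|ne] := eqVneq w v; first exact: prime_site_serves.
by apply: far_serves_hits; exact: fv.
Qed.

(** At level 0 both points are prime sites hitting complementary sets of cells; among these sites
    only a cell center and the opposite midpoint do so. *)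
Lemma two_means_classification s : (size s <= 2)%N -> s != [::] ->
  distort P s <= (13 * 3 ^+ 0 - 4 * 2%:R) / (54 * 27 ^+ 0) ->
  exists j, [set` s] = [set` [:: sub_center R j; mid_center R j]].
Proof.
move=> s2 s0 D.
have [] := distort_eq s0 s2 D.
case: s {s2 s0 D} => [|a [|b [|]]] // _ site cnt.
have {}cnt j : (hits a j + hits b j)%N = 1%N.
  by have := cnt [tuple] j; rewrite /= addn0.
have pa : prime_site a by have [w] := site a (mem_head _ _); rewrite (tuple0 w).
have pb : prime_site b.
  by have [|w] := site b; rewrite ?inE ?eqxx ?orbT // (tuple0 w).
have c0 := cnt ord0; have c1 := cnt (lift ord0 ord0).
have c2 := cnt (lift ord0 (lift ord0 ord0)).
move: pa pb c0 c1 c2 => [->|[j [->|->]]] [->|[k [->|->]]];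
  rewrite ?hits_centroid ?hits_sub_center ?hits_mid_center.
- by [].
- by elim/ord3P: k.
- by elim/ord3P: k.
- by elim/ord3P: j.
- by elim/ord3P: j; elim/ord3P: k.
- have [-> _ _ _|jk] := eqVneq j k; first by exists k.
  by move: jk; elim/ord3P: j; elim/ord3P: k.
- by elim/ord3P: j.
- have [-> _ _ _|jk] := eqVneq j k.
    by exists k; apply/seteqP; split=> x /=; rewrite !inE orbC.
  by move: jk; elim/ord3P: j; elim/ord3P: k.
- by elim/ord3P: j; elim/ord3P: k.
Qed.

Lemma S_word_invK l (w : word l) : cancel (@S_word_inv R w) (S_word w).
Proof.
rewrite /S_word => a; elim: (tval w) a => [|j v IH] a //=.
by rewrite IH S_invK.
Qed.

Lemma S_wordK l (w : word l) : cancel (@S_word R l w) (S_word_inv w).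
Proof.
by rewrite /S_word => a; elim: (tval w) a => [|j v IH] a //=; rewrite S_K IH.
Qed.

(** Each point serves one cell and each cell is served, so with [3 ^ l] points the correspondence
    [f] is bijective. The single point of a cell hits all three subcells and is therefore its
    center. *)
Lemma power_means_unique l s : (size s <= 3 ^ l)%N -> s != [::] ->
  distort P s <= (13 * 3 ^+ l - 4 * (3 ^ l)%:R) / (54 * 27 ^+ l) ->
  [set` s] = @alpha_pow R l.
Proof.
move=> sn s0 D.
have [sizeE site cnt] := distort_eq s0 sn D.
have sel a : exists w : word l, a \in s -> prime_site (S_word_inv w a) /\
    forall w' : word l, w' != w -> far (S_word_inv w' a).
  have [sa|] := boolP (a \in s); last by exists [tuple of nseq l ord0].
  by have [w ? ?] := site a sa; exists w.
have [f fP] := boolp.choice sel.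
have fE a (w : word l) j : a \in s -> hits (S_word_inv w a) j -> f a = w.
  move=> sa h; apply/eqP; apply: contraT; rewrite eq_sym => ne.
  by move: h; rewrite far_hits //; apply: (fP a sa).2.
have onto (w : word l) j : exists2 a, a \in s & hits (S_word_inv w a) j.
  by apply/hasP; rewrite has_count cnt.
have f_uniq : uniq (map f s).
  apply: (@leq_size_uniq _ (enum {: word l})); first exact: enum_uniq.
    by move=> w _; have [a sa h] := onto w ord0; rewrite -(fE a w _ sa h) map_f.
  by rewrite size_map sizeE -cardE card_tuple card_ord.
have f_inj a b : a \in s -> b \in s -> f a = f b -> a = b.
  move=> sa sb e; rewrite -(nth_index a sa) -[RHS](nth_index a sb).
  congr nth; apply/eqP; rewrite -(nth_uniq (f a) _ _ f_uniq) ?size_map ?index_mem //.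
  by rewrite !(nth_map a) ?index_mem // !nth_index // e.
have full a : a \in s -> S_word_inv (f a) a = centroid R.
  move=> sa; have H j : hits (S_word_inv (f a) a) j.
    have [b sb h] := onto (f a) j.
    by move: (h); rewrite -(f_inj a b sa sb (esym (fE b (f a) j sb h))).
  have [//|[j [e|e]]] := (fP a sa).1.
    have := H ord0; have := H (lift ord0 ord0); rewrite e !hits_sub_center.
    by elim/ord3P: j {e}.
  by have := H j; rewrite e hits_mid_center eqxx.
apply/seteqP; split=> [a /= sa|_ [w _ <-] /=].
  by exists (f a) => //; rewrite -[RHS](S_word_invK (f a)) full.
have [a sa h] := onto w ord0; rewrite /a_ -/(centroid R).
by rewrite -(fE a w _ sa h) -(full a sa) S_word_invK.
Qed.

End Equality.

(** * Optimal sets built from words *)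

Section Counting.

(** Candidate sets are coded by [c]: [Some j] selects the [j]-th optimal pair in a cell, [None] the
    default pattern. *)
Definition some_set (T : finType) (U : Type) (c : T -> option U) : {set T} :=
  [set w | isSome (c w)]%SET.

Lemma card_some_set (T : finType) (U : finType) (k : nat) :
  #|[set c : {ffun T -> option U} | #|some_set c| == k]%SET| =
  ('C(#|T|, k) * #|U| ^ k)%N.
Proof.
rewrite -sum1dep_card.
rewrite (partition_big (fun c : {ffun T -> option U} => some_set c)
  (fun J : {set T} => #|J| == k)) //=.
rewrite (eq_bigr (fun=> #|U| ^ k)%N); last first.
  (* Codes with domain [J] form a product: any value on [J], only [None] elsewhere. *)
  move=> J /eqP <-; pose F w : pred (option U) :=
    if w \in J then [pred o | isSome o] else pred1 None.
  rewrite (eq_bigl (fun c => c \in family F)); last first.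
    move=> c; apply/andP/familyP => [[_ /eqP cJ] w|H].
      by rewrite /F -cJ inE !unfold_in; case: (c w).
    suff -> : some_set c = J by rewrite eqxx.
    apply/setP => w; rewrite inE; have := H w; rewrite /F.
    by case: (w \in J) => //; rewrite !unfold_in => /eqP ->.
  rewrite sum1_card card_family foldrE big_map big_enum /=.
  rewrite (bigID (mem J)) /= [X in (_ * X)%N]big1 ?muln1; last first.
    by move=> w /negbTE wJ; rewrite /F wJ card1.
  rewrite (eq_bigr (fun=> #|U|)); last first.
    move=> w wJ; rewrite /F wJ -[RHS]/(#|U|.+1.-1) -card_option -(cardC1 None).
    by apply: eq_card => -[u|].
  by rewrite prod_nat_const.
by rewrite sum_nat_const -card_draws cardsE.
Qed.

End Counting.

#[local] Arguments cx [R] x : simpl never.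
#[local] Arguments cy [R] x : simpl never.

(** * Explicit point sets attaining the bound *)

Section UpperBound.
Context (R : realType) (P : probability (plane R) R).
Hypothesis P_self_similar : self_similar P.
Implicit Types (x y a b : plane R) (s m : seq (plane R)) (j k : 'I_3).

Lemma distort_subset s t : s != [::] -> {subset s <= t} -> distort P t <= distort P s.
Proof.
move=> s0 st; have t0 : t != [::].
  by case: t st => //; case: s s0 => // a s _ /(_ a (mem_head _ _)).
apply: le_mean => //; [exact: tame_sqdist|exact: tame_sqdist|].
by move=> x _; have [a sa ->] := sqdist_mem x s0; apply: sqdist_le; exact: st.
Qed.

(** Each cell [j] is assigned to a fixed point [b j], which need not be nearest; its cost then
    follows from [mean_dist2]. *)
Lemma distort_cells_le s (b : 'I_3 -> plane R) : (forall j, b j \in s) ->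
  distort P s <= 1 / 27 * \sum_(j < 3) (1 / 6 + dist2 (centroid R) (S_inv j (b j))).
Proof.
move=> bs; have s0 : s != [::] by case: s bs => // /(_ ord0).
rewrite /distort (mean_self_similar P_self_similar (tame_sqdist s0)).
rewrite (_ : 1 / 27 = 1 / 3 * (1 / 9)); last by field.
rewrite -[leRHS]mulrA ler_pM2l // mulr_sumr; apply: ler_sum => j _.
rewrite -(mean_dist2 P_self_similar) -meanZ //; last exact: tame_dist2.
apply: le_mean => //; first exact: (tame_S j (tame_sqdist s0)).
  by apply: tameM; [exact: tame_cst|exact: tame_dist2].
move=> x _; apply: le_trans (sqdist_le _ (bs j)) _.
by rewrite dist2_S div1r mulrC.
Qed.

Definition sites l (Y : word l -> seq (plane R)) : seq (plane R) :=
  flatten [seq map (S_word w) (Y w) | w <- enum {: word l}].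

Lemma mem_sites l (Y : word l -> seq (plane R)) x :
  x \in sites Y <-> exists w, exists2 y, y \in Y w & x = S_word w y.
Proof.
split=> [/flattenP[_ /mapP[w _ ->] /mapP[y yY ->]]|[w [y yY ->]]].
  by exists w, y.
by apply/flattenP; exists (map (S_word w) (Y w)); apply: map_f; rewrite ?mem_enum.
Qed.

Lemma size_sites l (Y : word l -> seq (plane R)) :
  size (sites Y) = \sum_(w : word l) size (Y w).
Proof.
rewrite size_flatten sumnE /shape 2!big_map big_enum /=.
by apply: eq_bigr => w _; rewrite size_map.
Qed.

Lemma sites_neq0 l (Y : word l -> seq (plane R)) :
  (forall w, Y w != [::]) -> sites Y != [::].
Proof.
move=> Y0; pose w := [tuple of nseq l (ord0 : 'I_3)].
have [y yY] : exists y, y \in Y w.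
  by case: (Y w) (Y0 w) => // y s _; exists y; exact: mem_head.
have : S_word w y \in sites Y by apply/mem_sites; exists w, y.
by case: (sites Y).
Qed.

(** Letting each cell use its own points costs [(13 - 4 k) / 54] for [k] points, up to scaling. This
    is affine in [k], so the total depends only on the number of points. *)
Lemma distort_sites_le l (Y : word l -> seq (plane R)) :
  (forall w, Y w != [::]) ->
  (forall w, distort P (Y w) <= (13 - 4 * (size (Y w))%:R) / 54) ->
  distort P (sites Y) <= (13 * 3 ^+ l - 4 * (size (sites Y))%:R) / (54 * 27 ^+ l).
Proof.
move=> Y0 HY; have p : 0 < 27 ^+ l :> R by rewrite exprn_gt0.
rewrite (distort_word P_self_similar l (sites_neq0 Y0)).
rewrite invfM mulrA [leRHS]mulrC ler_pM2l ?invr_gt0 //.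
apply: le_trans (_ : \sum_(w : word l) (13 - 4 * (size (Y w))%:R) / 54 <= _).
  apply: ler_sum => w _; apply: le_trans (HY w); apply: distort_subset => // y yY.
  apply/mapP; exists (S_word w y); last by rewrite S_wordK.
  by apply/mem_sites; exists w, y.
rewrite -mulr_suml sumrB -mulr_sumr size_sites natr_sum.
by rewrite sumr_const card_tuple card_ord -[_ *+ (3 ^ l)]mulr_natr natrX.
Qed.

Definition pair_sites j := [:: sub_center R j; mid_center R j].

(** The default pattern [m] is the centroid for the low family and [third_sites] for the high
    one. *)
Definition cell_sites m (o : option 'I_3) := if o is Some j then pair_sites j else m.

Definition third_sites := [:: sub_center R ord0; sub_center R (lift ord0 ord0);
  sub_center R (lift ord0 (lift ord0 ord0))].

Lemma distort_centroid : distort P [:: centroid R] <= (13 - 4 * 1%:R) / 54.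
Proof.
apply: le_trans (distort_cells_le (b := fun=> centroid R) _) _.
  by move=> j; rewrite inE.
rewrite !big_ord_recl big_ord0 /dist2 !cx_S_inv !cy_S_inv.
by rewrite cx_centroid cy_centroid !cx_vertex !cy_vertex /=; lra.
Qed.

Lemma distort_pair j : distort P (pair_sites j) <= (13 - 4 * 2%:R) / 54.
Proof.
apply: le_trans (distort_cells_le
  (b := fun k => if k == j then sub_center R j else mid_center R j) _) _.
  by move=> k; case: ifP; rewrite !inE eqxx ?orbT.
rewrite !big_ord_recl big_ord0 /dist2 !cx_S_inv !cy_S_inv.
by elim/ord3P: j => /=; rewrite ?cx_mid_center ?cy_mid_center !cx_S !cy_S
  !(cx_centroid, cy_centroid) !cx_vertex !cy_vertex /=; lra.
Qed.

Lemma distort_third : distort P third_sites <= (13 - 4 * 3%:R) / 54.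
Proof.
apply: le_trans (distort_cells_le (b := fun k => sub_center R k) _) _.
  by elim/ord3P; rewrite !inE eqxx ?orbT.
rewrite !big_ord_recl big_ord0 /dist2 !cx_S_inv !cy_S_inv.
by rewrite !cx_S !cy_S cx_centroid cy_centroid !cx_vertex !cy_vertex /=; lra.
Qed.

Lemma triangle_S_seq (w : seq 'I_3) x : triangle x -> triangle (S_seq w x).
Proof. by elim: w => //= j w IH Tx; apply: triangle_S; exact: IH. Qed.

Lemma triangle_bary_le1 i x : triangle x -> bary i x <= 1.
Proof.
move=> Tx; have := bary_sum x; have := Tx ord0; have := Tx (lift ord0 ord0).
have := Tx (lift ord0 (lift ord0 ord0)).
by elim/ord3P: i; lra.
Qed.

(** The [i]-th coordinate is at least [2 / 3] on cell [i] and at most [1 / 3] on the other cells, so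
    first letters agree; then induction. *)
Lemma S_word_disjoint l (v w : word l) x y : triangle x -> triangle y ->
  S_word v x = S_word w y -> v = w.
Proof.
move=> Tx Ty e; apply: val_inj; rewrite /=; move: e.
rewrite -[S_word v]/(S_seq v) -[S_word w]/(S_seq w).
have : size v = size w by rewrite !size_tuple.
elim: (v : seq 'I_3) (w : seq 'I_3) => [|i v' IH] [|j w'] //= [sz] e.
have ij : i = j.
  apply/eqP; apply: contraT => ne.
  have := congr1 (bary i) e; rewrite !bary_S eqxx (negbTE ne) /=.
  have := triangle_S_seq v' Tx i.
  by have := triangle_bary_le1 i (triangle_S_seq w' Ty); lra.
move: e; rewrite ij => /(can_inj (S_K j)) e; congr (_ :: _); exact: IH.
Qed.

Lemma sub_center_triangle j : triangle (sub_center R j).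
Proof. by apply: triangle_S; exact: centroid_in_triangle. Qed.

Lemma mid_center_triangle j : triangle (mid_center R j).
Proof.
move=> i; rewrite /bary cx_mid_center cy_mid_center !cx_S !cy_S.
rewrite cx_centroid cy_centroid !cx_vertex !cy_vertex.
by elim/ord3P: i; elim/ord3P: j => /=; lra.
Qed.

Lemma cell_sites_triangle m o : (forall y, y \in m -> triangle y) ->
  forall y, y \in cell_sites m o -> triangle y.
Proof.
move=> Tm y; case: o => [j|]; last exact: Tm.
by rewrite !inE => /orP[/eqP ->|/eqP ->];
  [exact: sub_center_triangle|exact: mid_center_triangle].
Qed.

(** Points are distinguished by the cells they hit: one for a cell center, two for a midpoint. *)
Lemma pair_sites_inj j k : pair_sites j =i pair_sites k -> j = k.
Proof.
move=> e; have := e (sub_center R j); rewrite mem_head !inE => /esym/orP[]/eqP h.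
  by have := hits_sub_center R j j; rewrite h hits_sub_center eqxx => /eqP.
have H i : (i == j) = (i != k) by rewrite -(hits_sub_center R) h hits_mid_center.
have := H ord0; have := H (lift ord0 ord0).
have := H (lift ord0 (lift ord0 ord0)).
by clear e h H; elim/ord3P: j; elim/ord3P: k.
Qed.

Lemma cell_sites_centroid_inj o o' :
  cell_sites [:: centroid R] o =i cell_sites [:: centroid R] o' -> o = o'.
Proof.
have H j : ~ cell_sites [:: centroid R] (Some j) =i [:: centroid R].
  move=> /(_ (sub_center R j)); rewrite mem_head inE => /esym/eqP h.
  have K i i' : (i == j) = (i' == j) by rewrite -!(hits_sub_center R) h !hits_centroid.
  have := K ord0 (lift ord0 ord0).
  have := K ord0 (lift ord0 (lift ord0 ord0)).
  by clear h K; elim/ord3P: j.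
case: o o' => [j|] [k|] // e; first by rewrite (pair_sites_inj e).
  by case: (H j e).
by case: (H k (fsym e)).
Qed.

Lemma cell_sites_third_inj o o' :
  cell_sites third_sites o =i cell_sites third_sites o' -> o = o'.
Proof.
have H j : ~ cell_sites third_sites (Some j) =i third_sites.
  move=> /(_ (mid_center R j)); rewrite /= !inE eqxx orbT => /esym.
  have {}H k : mid_center R j = sub_center R k -> False.
    move=> h; have {}h i : (i == k) = (i != j).
      by rewrite -(hits_sub_center R) -h hits_mid_center.
    have := h ord0; have := h (lift ord0 ord0).
    have := h (lift ord0 (lift ord0 ord0)).
    by clear h; elim/ord3P: j; elim/ord3P: k.
  by move=> /or3P[] /eqP /H.
case: o o' => [j|] [k|] // e; first by rewrite (pair_sites_inj e).
  by case: (H j e).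
by case: (H k (fsym e)).
Qed.

(** The cells are disjoint, so the pattern in each of them can be recovered from the union. *)
Lemma sites_inj l m (c c' : {ffun word l -> option 'I_3}) :
  (forall y, y \in m -> triangle y) ->
  (forall o o', cell_sites m o =i cell_sites m o' -> o = o') ->
  [set` sites (fun w => cell_sites m (c w))] =
  [set` sites (fun w => cell_sites m (c' w))] -> c = c'.
Proof.
move=> Tm minj e; apply/ffunP => w; apply: minj => y.
have H (d d' : {ffun word l -> option 'I_3}) :
    [set` sites (fun w => cell_sites m (d w))] =
    [set` sites (fun w => cell_sites m (d' w))] ->
    y \in cell_sites m (d w) -> y \in cell_sites m (d' w).
  move=> E yd; have : S_word w y \in sites (fun w => cell_sites m (d w)).
    by apply/mem_sites; exists w, y.
  move=> H; have : [set` sites (fun w => cell_sites m (d w))] (S_word w y) by [].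
  rewrite E /= => /mem_sites[v [z zd' yz]].
  have wv : w = v.
    apply: S_word_disjoint yz; first exact: cell_sites_triangle yd.
    exact: cell_sites_triangle zd'.
  by move: yz zd'; rewrite -wv => /(can_inj (@S_wordK R l w)) ->.
by apply/idP/idP; apply: H.
Qed.

End UpperBound.

(** * Quantization error, optimal sets and their number *)

Section Optimality.
Context (R : realType) (P : probability (plane R) R).
Hypothesis P_self_similar : self_similar P.
Implicit Types (x y a b : plane R) (s m : seq (plane R)) (j k : 'I_3).

Definition error_value (n l : nat) : R :=
  (13 * 3 ^+ l - 4 * n%:R) / (54 * 27 ^+ l).

Lemma error_value_anti n n' l : (n' <= n)%N -> error_value n l <= error_value n' l.
Proof.
move=> nn'; rewrite /error_value ler_pM2r ?invr_gt0 ?mulr_gt0 ?exprn_gt0 //.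
by rewrite lerD2l lerN2 ler_pM2l // ler_nat.
Qed.

Lemma codebook_seq s n : s != [::] -> (size s <= n)%N -> codebook n [set` s].
Proof.
move=> s0 sn; split; last exact: card_le_seq.
by case: s s0 {sn} => // a s _; exists a; rewrite /= mem_head.
Qed.

Lemma distortion_ge n l A : codebook n A -> ((error_value n l)%:E <= distortion P A)%E.
Proof.
move=> /codebookP[s [_ s0 -> sn]]; rewrite distortionE // lee_fin.
exact: le_trans (error_value_anti _ sn) (distort_ge P_self_similar l s0).
Qed.

Lemma quantization_error_seq n l s : s != [::] -> (size s <= n)%N ->
  distort P s <= error_value n l -> quantization_error P n = (error_value n l)%:E.
Proof.
move=> s0 sn D; apply/eqP; rewrite eq_le; apply/andP; split.
  apply: (@le_trans _ _ (distortion P [set` s])).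
    by apply: ereal_inf_lbound; exists [set` s] => //; exact: codebook_seq.
  by rewrite distortionE // lee_fin.
by apply: le_ereal_inf_tmp => _ [A cA <-]; exact: distortion_ge.
Qed.

Lemma optimal_seq n l s : s != [::] -> (size s <= n)%N ->
  distort P s <= error_value n l -> optimal_means P n [set` s].
Proof.
move=> s0 sn D; split; first exact: codebook_seq.
rewrite (quantization_error_seq s0 sn D); apply/eqP; rewrite eq_le.
by rewrite distortion_ge ?andbT; [rewrite distortionE // lee_fin|exact: codebook_seq].
Qed.

Lemma optimalP n l A : quantization_error P n = (error_value n l)%:E ->
  optimal_means P n A ->
  exists s, [/\ A = [set` s], s != [::], (size s <= n)%N &
    distort P s <= error_value n l].
Proof.
move=> qe [/codebookP[s [_ s0 -> sn]]]; rewrite qe distortionE // => -[D].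
by exists s; rewrite D.
Qed.

Lemma error_value0 n : error_value n 0 = (13 - 4 * n%:R) / 54.
Proof. by rewrite /error_value !expr0 !mulr1. Qed.

Lemma optimal_two_means A :
  optimal_means P 2 A <-> exists j, A = [set` pair_sites R j].
Proof.
have D j : distort P (pair_sites R j) <= error_value 2 0.
  by rewrite error_value0; exact: distort_pair.
split=> [|[j ->]]; last exact: optimal_seq (D j).
have qe := quantization_error_seq (n := 2) (s := pair_sites R ord0) isT isT (D ord0).
move=> /(optimalP qe)[s [-> s0 s2 Ds]].
exact: two_means_classification Ds.
Qed.

Lemma optimal_three_means A : optimal_means P 3 A <-> A = [set` third_sites R].
Proof.
(* The values of levels 0 and 1 agree at three points; level 1 is chosen because uniqueness for
   powers of 3 applies there. *)
have D : distort P (third_sites R) <= error_value 3 1.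
  apply: le_trans (distort_third P_self_similar) _.
  by rewrite /error_value !expr1; lra.
have U := power_means_unique P_self_similar (l := 1).
split=> [|->]; last exact: optimal_seq D.
have qe := quantization_error_seq (n := 3) (s := third_sites R) isT isT D.
move=> /(optimalP qe)[s [-> s0 s3 Ds]].
by rewrite (U s) // -(U (third_sites R)).
Qed.

Definition assembled l m (c : word l -> option 'I_3) : set (plane R) :=
  [set` sites (fun w => cell_sites m (c w))].

Lemma assembledE l m (c : word l -> option 'I_3) :
  assembled m c = \bigcup_w (S_word w @` [set` cell_sites m (c w)]).
Proof.
apply/seteqP; split=> x /=.
  by move=> /mem_sites[w [y yY ->]]; exists w => //; exists y.
by move=> [w _ [y yY <-]]; apply/mem_sites; exists w, y.
Qed.

(** The additive form avoids truncated subtraction and covers default patterns with fewer or more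
    than two points. *)
Lemma size_assembled l m (c : word l -> option 'I_3) :
  (size (sites (fun w => cell_sites m (c w))) + size m * #|some_set c| =
   size m * 3 ^ l + 2 * #|some_set c|)%N.
Proof.
rewrite size_sites (bigID (mem (some_set c))) /=.
rewrite (eq_bigr (fun=> 2)%N); last first.
  by move=> w; rewrite inE; case: (c w).
rewrite [X in (_ + X + _)%N](eq_bigr (fun=> size m)); last first.
  by move=> w; rewrite inE; case: (c w).
rewrite !sum_nat_const.
have <- : (#|some_set c| + #|[pred w | w \notin some_set c]| = 3 ^ l)%N.
  transitivity #|{: word l}|; last by rewrite card_tuple card_ord.
  exact: (cardC (mem (some_set c))).
set u := #|_|; set v := #|_|; lia.
Qed.

Lemma assembled_optimal n l m (c : word l -> option 'I_3) : m != [::] ->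
  distort P m <= (13 - 4 * (size m)%:R) / 54 ->
  (n + size m * #|some_set c| = size m * 3 ^ l + 2 * #|some_set c|)%N ->
  optimal_means P n (assembled m c) /\
  quantization_error P n = (error_value n l)%:E.
Proof.
move=> m0 Dm; rewrite -size_assembled => /addIn ->.
have Y0 w : cell_sites m (c w) != [::] by case: (c w).
have D : distort P (sites (fun w => cell_sites m (c w))) <=
    error_value (size (sites (fun w => cell_sites m (c w)))) l.
  apply: (distort_sites_le P_self_similar) => // w.
  by case: (c w) => [j|] //; exact: distort_pair.
by split; [apply: optimal_seq D|apply: quantization_error_seq D];
  rewrite ?sites_neq0.
Qed.

Lemma card_image_finset (T : finType) (U : Type) (f : T -> U) (C : {set T}) :
  injective f -> (f @` [set` C] #= `I_#|C|)%card.
Proof.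
move=> f_inj; apply: card_eq_trans (_ : ([set` C] #= _)%card).
  by apply: inj_card_eq => x y _ _; exact: f_inj.
have [->|[x0 x0C]] := set_0Vmem C.
  rewrite cards0 II0 card_eq0; apply/eqP/seteqP.
  by split=> x //=; rewrite inE.
rewrite (_ : [set` C] = nth x0 (enum C) @` `I_#|C|).
  apply: inj_card_eq => i j /set_mem /= iC /set_mem /= jC /eqP.
  by rewrite nth_uniq -?cardE ?enum_uniq // => /eqP.
apply/seteqP; split=> [x /= xC|_ [i /= iC <-]].
  exists (index x (enum C)); last by rewrite nth_index ?mem_enum.
  by rewrite /= cardE index_mem mem_enum.
by rewrite -mem_enum mem_nth -?cardE.
Qed.

Lemma card_assembled l m (k : nat) :
  (forall y, y \in m -> triangle y) ->
  (forall o o', cell_sites m o =i cell_sites m o' -> o = o') ->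
  ([set assembled m c | c in
      [set c : {ffun word l -> option 'I_3} | #|some_set c| = k]] #=
   `I_('C(3 ^ l, k) * 3 ^ k))%card.
Proof.
move=> Tm minj.
have := card_image_finset [set c : {ffun word l -> option 'I_3} | #|some_set c| == k]%SET
  (f := fun c : {ffun word l -> option 'I_3} => assembled m c)
  (fun c c' => sites_inj Tm minj).
rewrite card_some_set card_tuple !card_ord; congr (_ #= _)%card.
congr (_ @` _); apply/seteqP; split=> c /=; first by rewrite inE => /eqP.
by move=> ck; rewrite inE ck.
Qed.

(** By [optimal_two_means] each [al2 w] with [w] in [J] is one of three pairs; choosing its letter
    gives the code. *)
Lemma assembledP l m (J : {set word l}) (al2 : word l -> set (plane R)) :
  (forall w, w \in J -> optimal_means P 2 (al2 w)) ->
  exists2 c : {ffun word l -> option 'I_3}, some_set c = J &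
    assembled m c =
      \bigcup_w (S_word w @` (if w \in J then al2 w else [set` m])).
Proof.
move=> o2; have sel w : exists j, w \in J -> al2 w = [set` pair_sites R j].
  have [wJ|_] := boolP (w \in J); last by exists ord0.
  by have [j jE] := (optimal_two_means _).1 (o2 w wJ); exists j.
have [f fE] := boolp.choice sel.
exists [ffun w => if w \in J then Some (f w) else None].
  by apply/setP => w; rewrite inE ffunE; case: (w \in J).
rewrite assembledE; apply: eq_bigcupr => w _; rewrite ffunE.
by case: ifP => //= wJ; rewrite fE.
Qed.

Lemma low_familyE n l : low_family P n l =
  [set assembled [:: centroid R] c | c in
    [set c : {ffun word l -> option 'I_3} | #|some_set c| = n - 3 ^ l]]%N.
Proof.
have E (J : {set word l}) (al2 : word l -> set (plane R)) : alpha_low J al2 =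
    \bigcup_w (S_word w @` (if w \in J then al2 w else [set` [:: centroid R]])).
  apply/seteqP; split=> x.
    move=> [[w /= wJ <-]|[w /= wJ [y yw <-]]]; exists w => //.
      by rewrite (negbTE wJ); exists (centroid R); rewrite //= mem_head.
    by rewrite wJ; exists y.
  move=> [w _]; case: ifPn => wJ [y yw <-]; first by right; exists w => //; exists y.
  by left; exists w => //; move: yw; rewrite /= inE => /eqP ->.
apply/seteqP; split=> A.
  move=> [J [al2 [cJ o2 ->]]].
  by have [c cE AE] := assembledP [:: centroid R] o2; exists c; rewrite /= ?cE // AE E.
move=> [c /= cn <-].
exists (some_set c), (fun w => [set` cell_sites [:: centroid R] (c w)]); split=> //.
  move=> w; rewrite inE; case: (c w) => // j _.
  by apply/optimal_two_means; exists j.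
rewrite E assembledE; apply: eq_bigcupr => w _.
by rewrite inE; case: (c w).
Qed.

(** In the high family [J] marks the cells with three points, so the code is defined on its
    complement. *)
Lemma high_familyE n l : (2 * 3 ^ l < n < 3 ^ l.+1)%N -> high_family P n l =
  [set assembled (third_sites R) c | c in
    [set c : {ffun word l -> option 'I_3} | #|some_set c| = 3 ^ l.+1 - n]]%N.
Proof.
move=> /andP[ln nl].
have E (J : {set word l}) (al2 : word l -> set (plane R)) :
    alpha_high J [set` third_sites R] al2 =
    \bigcup_w (S_word w @` (if w \in ~: J then al2 w else [set` third_sites R]))%SET.
  apply/seteqP; split=> x.
    move=> [[w /= wJ [y yw <-]]|[w /= wJ [y yw <-]]]; exists w => //.
      by rewrite inE wJ; exists y.
    by rewrite inE wJ; exists y.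
  move=> [w _]; rewrite inE; case: ifPn => wJ [y yw <-].
    by right; exists w => //; exists y.
  by left; exists w; [move: wJ; rewrite negbK|exists y].
have cardJ (J : {set word l}) : (#|J| + #|~: J|%SET = 3 ^ l)%N.
  by rewrite cardsC card_tuple card_ord.
apply/seteqP; split=> A.
  move=> [J [al3 [al2 [cJ /optimal_three_means -> o2 ->]]]].
  have o2' w : w \in (~: J)%SET -> optimal_means P 2 (al2 w).
    by rewrite inE; exact: o2.
  have [c cE AE] := assembledP (third_sites R) o2'; exists c; rewrite ?AE ?E //= cE.
  by have := cardJ J; move: ln nl; rewrite cJ expnS; move: (3 ^ l)%N #|_| => p q; lia.
move=> [c /= cn <-].
exists (~: some_set c)%SET, [set` third_sites R],
  (fun w => [set` cell_sites (third_sites R) (c w)]); split=> //.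
- have := cardJ (some_set c); rewrite cn; move: ln nl; rewrite expnS.
  by move: (3 ^ l)%N #|_| => p q; lia.
- exact/optimal_three_means.
- move=> w; rewrite !inE negbK; case: (c w) => // j _.
  by apply/optimal_two_means; exists j.
rewrite E assembledE; apply: eq_bigcupr => w _.
by rewrite !inE; case: (c w).
Qed.

Lemma alpha_powE l :
  @alpha_pow R l = @assembled l [:: centroid R] (fun=> None).
Proof.
rewrite assembledE; apply/seteqP; split=> x.
  by move=> [w _ <-]; exists w => //; exists (centroid R); rewrite //= mem_head.
by move=> [w _ [y]]; rewrite /= inE => /eqP -> <-; exists w.
Qed.

End Optimality.

Theorem theorem3p14 (R : realType) (P : probability (plane R) R)
    (P_self_similar : self_similar P)
    (n l : nat) (n_ge3 : (3 <= n)%N) (nl : (3 ^ l <= n < 3 ^ l.+1)%N) :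
  [/\ n = (3 ^ l)%N ->
        optimal_means P n (alpha_pow l) /\
        (forall A, optimal_means P n A -> A = alpha_pow l),
      (3 ^ l < n <= 2 * 3 ^ l)%N ->
        (forall A, low_family P n l A -> optimal_means P n A) /\
        (low_family P n l #= `I_('C(3 ^ l, n - 3 ^ l) * 3 ^ (n - 3 ^ l)))%card,
      (2 * 3 ^ l < n < 3 ^ l.+1)%N ->
        (forall A, high_family P n l A -> optimal_means P n A) /\
        (high_family P n l #=
           `I_('C(3 ^ l, n - 2 * 3 ^ l) * 3 ^ (3 ^ l.+1 - n)))%card
    & quantization_error P n =
        (1 / 2 * (1 / 27 ^+ l.+1) * (13 * 3 ^+ l - 4 * n%:R))%:E].
Proof.
have [c1 c3] : distort P [:: centroid R] <= (13 - 4 * 1%:R) / 54 /\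
    distort P (third_sites R) <= (13 - 4 * 3%:R) / 54.
  by split; [exact: distort_centroid|exact: distort_third].
have low (c : word l -> option 'I_3) : (3 ^ l <= n)%N -> #|some_set c| = (n - 3 ^ l)%N ->
    optimal_means P n (assembled [:: centroid R] c) /\
    quantization_error P n = (error_value R n l)%:E.
  by move=> ln ck; apply: assembled_optimal => //=; rewrite ck; lia.
have high (c : word l -> option 'I_3) : (2 * 3 ^ l < n < 3 ^ l.+1)%N ->
    #|some_set c| = (3 ^ l.+1 - n)%N ->
    optimal_means P n (assembled (third_sites R) c) /\
    quantization_error P n = (error_value R n l)%:E.
  by move=> ln ck; apply: assembled_optimal => //=; rewrite ck; move: ln;
    rewrite expnS; lia.
(* The positive count supplies one code of each size, which is enough to determine the error. *)
have exc k : (k <= 3 ^ l)%N -> exists c : {ffun word l -> option 'I_3}, #|some_set c| = k.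
  move=> kl.
  have : (0 < #|[set c : {ffun word l -> option 'I_3} | #|some_set c| == k]%SET|)%N.
    by rewrite card_some_set card_tuple !card_ord muln_gt0 bin_gt0 kl expn_gt0.
  by move=> /card_gt0P[c]; rewrite inE => /eqP ck; exists c.
have qe : quantization_error P n = (error_value R n l)%:E.
  have [n2|n2] := leqP n (2 * 3 ^ l).
    have [|c ck] := exc (n - 3 ^ l)%N; first by lia.
    by have [] := low c _ ck; first by case/andP: nl.
  have [|c ck] := exc (3 ^ l.+1 - n)%N; first by move: nl; rewrite expnS; lia.
  by have [] := high c _ ck; first by case/andP: nl => _ ->; rewrite n2.
split.
- move=> nE; split.
    (* The set of cell centers is the low case with the code [None] everywhere. *)
    rewrite alpha_powE; apply: (low _ _ _).1; first by rewrite nE.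
    rewrite nE subnn; apply/eqP; rewrite cards_eq0; apply/eqP/setP => w.
    by rewrite !inE.
  move=> A /(optimalP P_self_similar qe)[s [-> s0 sn D]].
  by apply: (power_means_unique P_self_similar) => //; rewrite -nE.
- move=> /andP[ln _]; rewrite (low_familyE P_self_similar); split.
    by move=> _ [c ck <-]; apply: (low _ _ ck).1; exact: ltnW.
  apply: card_assembled => //; last exact: cell_sites_centroid_inj.
  by move=> y; rewrite inE => /eqP ->; exact: centroid_in_triangle.
- move=> ln; rewrite (high_familyE P_self_similar ln); split.
    by move=> _ [c ck <-]; exact: (high _ ln ck).1.
  (* Symmetry of binomials: codes count the cells with pairs, the statement those with three
     points. *)
  have -> : 'C(3 ^ l, n - 2 * 3 ^ l) = 'C(3 ^ l, 3 ^ l.+1 - n).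
    rewrite -bin_sub; last by move: ln; rewrite expnS; lia.
    by congr ('C(_, _)); move: ln; rewrite expnS; lia.
  apply: card_assembled => //; last exact: cell_sites_third_inj.
  by move=> y; rewrite !inE => /or3P[] /eqP ->; exact: sub_center_triangle.
(* Both denominators agree, since [2 * 27 ^+ l.+1 = 54 * 27 ^+ l]. *)
- rewrite qe /error_value exprS; congr (_%:E).
  have h : (27 ^+ l : R) != 0 by rewrite expf_neq0.
  by field; rewrite h.
Qed.
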